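(* For every $n\ge1$, $$\{X(T): T\in\mathrm{Tree}_n\}=\{w^{-1}X_w^{w\mathbf{c}}: w\in S_{n-1}\}$$ as sets of subvarieties of $\mathrm{Fl}_n$. In particular, there are $\mathrm{Cat}_{n-1}=\frac1n\binom{2n-2}{n-1}$ distinct translated Richardson varieties $w^{-1}X_w^{w\mathbf{c}}$, one for each $T\in\mathrm{Tree}_n$.
   Context: Work over $\mathbb{C}$. $\mathrm{Fl}_m=\mathrm{GL}_m/B_m$ is the complete flag variety of $\mathbb{C}^m$, with $B=B_m$ (resp. $B^-$) the upper (resp. lower) triangular matrices and $hB$ corresponding to the flag whose $j$th subspace is the span of the first $j$ columns of $h$. Permutations act on $\mathrm{Fl}_n$ by left multiplication by permutation matrices ($w$ has $1$'s in positions $(w(j),j)$). For $u\le v$ in Bruhat order, $X_u^v=\overline{BvB}\cap\overline{B^-uB}$ is the Richardson variety. $\mathbf{c}=(n\ n-1\ \cdots\ 2\ 1)\in S_n$ is the backwards long cycle, and $S_{n-1}\subset S_n$ is the set of permutations $w$ with $w(n)=n$ (for which $w\le w\mathbf{c}$). $\mathrm{Tree}_n$ is the set of planar binary trees with $n$ leaves (each node is a leaf or an internal node with a left and a right child). Every $T\in\mathrm{Tree}_n$ is obtained from the one-leaf tree via some sequence $(i_1,\dots,i_{n-1})$ with $1\le i_j\le j$, where step $j$ replaces the $i_j$th leaf from the left by an internal node with two leaf children. Let $\epsilon_i:\mathbb{C}^{m-1}\to\mathbb{C}^m$ insert a $0$ as the $i$th coordinate and let $e_1,\dots,e_m$ be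 the standard basis. For $Z\subset \mathrm{Fl}_{m-1}$ and $1\le i\le m-1$, $\mathbb{P}_iZ\subset \mathrm{Fl}_m$ is the set of flags $\mathcal{G}$ for which there is $\mathcal{F}\in Z$ with $\mathcal{G}_j=\epsilon_i(\mathcal{F}_j)$ for $j<i$ and $\mathcal{G}_j=\epsilon_i(\mathcal{F}_{j-1})\oplus\langle e_i\rangle$ for $j>i$ ($\mathcal{G}_i$ arbitrary). Then $X(T)=\mathbb{P}_{i_{n-1}}\cdots\mathbb{P}_{i_1}\mathrm{Fl}_1\subset\mathrm{Fl}_n$, which depends only on $T$. *)

(* Defs.v *)
From mathcomp Require Import all_boot all_order all_fingroup all_algebra.
From mathcomp Require Import classical_sets.
From mathcomp Require Import mpoly.

Set Implicit Arguments.
Unset Strict Implicit.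
Unset Printing Implicit Defensive.

Import GRing.Theory.
Local Open Scope classical_set_scope.
Local Open Scope ring_scope.

(** * The complete flag variety *)

(* Sequences F_0, ..., F_n of subspaces of K^n.  Subvarieties of the flag
   variety are sets of K-points, hence the restriction to closed fields. *)
Notation subspaces K n := {ffun 'I_n.+1 -> {vspace 'cV[K]_n}}.

Definition Fl (K : closedFieldType) (n : nat) : set (subspaces K n) :=
  [set F : subspaces K n | (forall j : 'I_n.+1, \dim (F j) = j :> nat) /\
           (forall i j : 'I_n.+1, (i <= j)%N -> (F i <= F j)%VS)].
Arguments Fl K n : clear implicits.

(* The flag hB: its j-th subspace is spanned by the first j columns of h. *)
Definition flag_of_mx (K : closedFieldType) (n : nat) (h : 'M[K]_n) :
    subspaces K n :=
  [ffun j : 'I_n.+1 => (\sum_(k < n | (k < j)%N) <[col k h]>)%VS].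

(* Left multiplication by a matrix on (sequences of) subspaces. *)
Definition mx_act (K : closedFieldType) (n : nat) (g : 'M[K]_n)
    (F : subspaces K n) : subspaces K n :=
  [ffun j => (linfun (mulmx g) @: F j)%VS].

(* The Zariski topology of Fl_n = GL_n / B is the quotient topology: a set of
   flags is closed when its preimage under h |-> hB is the zero locus in GL_n
   of a family of polynomials in the n^2 matrix entries. *)
Definition Fl_closed (K : closedFieldType) (n : nat)
    (Z : set (subspaces K n)) : Prop :=
  Z `<=` Fl K n /\
  exists S : set {mpoly K[n * n]}, forall h : 'M[K]_n, h \in unitmx ->
    (Z (flag_of_mx h) <-> forall p, S p -> p.@[fun k => mxvec h 0 k] = 0).

Definition Fl_closure (K : closedFieldType) (n : nat)
    (A : set (subspaces K n)) : set (subspaces K n) :=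
  smallest (@Fl_closed K n) A.

(** * Richardson varieties *)

Definition borel (K : closedFieldType) (n : nat) : set 'M[K]_n :=
  [set b | b \in unitmx /\ is_trig_mx b^T].
Arguments borel K n : clear implicits.

Definition opp_borel (K : closedFieldType) (n : nat) : set 'M[K]_n :=
  [set b | b \in unitmx /\ is_trig_mx b].
Arguments opp_borel K n : clear implicits.

(* 1's in positions (w(j), j); this is the transpose of [perm_mx w]. *)
Definition perm_matrix (K : closedFieldType) (n : nat) (w : 'S_n) : 'M[K]_n :=
  \matrix_(i, j) (i == w j)%:R.
Arguments perm_matrix K {n} w.

(* The image in Fl_n of the double coset H w B. *)
Definition cell (K : closedFieldType) (n : nat) (H : set 'M[K]_n) (w : 'S_n) :
    set (subspaces K n) :=
  [set F | exists h b, [/\ H h, borel K n b &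
     F = flag_of_mx (h *m perm_matrix K w *m b)]].

(* X_u^v; the intersection is empty unless u <= v in Bruhat order. *)
Definition richardson (K : closedFieldType) (n : nat) (u v : 'S_n) :
    set (subspaces K n) :=
  Fl_closure (cell (borel K n) v) `&` Fl_closure (cell (opp_borel K n) u).
Arguments richardson K {n} u v.

(* The backwards long cycle i |-> i - 1. *)
Definition back_cycle (n : nat) : 'S_n := perm (@ord_pred_inj n).

(* w^-1 X_w^(w c).  Products in 'S_n compose from left to right, so the
   composite function w o c is [c * w]. *)
Definition translated_richardson (K : closedFieldType) (n : nat) (w : 'S_n) :
    set (subspaces K n) :=
  mx_act (perm_matrix K w^-1%g) @` richardson K w (back_cycle n * w)%g.
Arguments translated_richardson K {n} w.

(* S_(n-1) inside S_n, with n = m.+1. *)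
Definition fix_last (m : nat) : set 'S_m.+1 :=
  [set w | w ord_max = ord_max].
Arguments fix_last m : clear implicits.

(** * Planar binary trees *)

Inductive tree := Leaf | Node (l r : tree).

Fixpoint nleaves (T : tree) : nat :=
  if T is Node l r then (nleaves l + nleaves r)%N else 1%N.

Definition Tree (n : nat) : set tree := [set T | nleaves T = n].

(* Replaces the i-th leaf from the left, counting from 0, by an internal node
   with two leaf children. *)
Fixpoint split_leaf (T : tree) (i : nat) : tree :=
  match T with
  | Leaf => Node Leaf Leaf
  | Node l r => if (i < nleaves l)%N then Node (split_leaf l i) r
                else Node l (split_leaf r (i - nleaves l))
  end.

(* A choice of leaf at every step: with indices counted from 0, step k acts on
   a tree with k+1 leaves.  Only the first m entries are used to reach a tree
   with m+1 leaves. *)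
Definition growth := forall k : nat, 'I_k.+1.

Fixpoint grow (s : growth) (m : nat) : tree :=
  if m is k.+1 then split_leaf (grow s k) (s k) else Leaf.

(** * The varieties X(T) *)

(* epsilon_i : K^m -> K^(m+1), inserting a 0 in position i. *)
Definition insert0_mx (K : closedFieldType) (m : nat) (i : 'I_m.+1) :
    'M[K]_(m.+1, m) :=
  \matrix_(k, l) (k == lift i l)%:R.
Arguments insert0_mx K {m} i.

Definition insert0 (K : closedFieldType) (m : nat) (i : 'I_m.+1)
    (V : {vspace 'cV[K]_m}) : {vspace 'cV[K]_m.+1} :=
  (linfun (mulmx (insert0_mx K i)) @: V)%VS.

(* The operation P_(i+1) from subsets of Fl_m to subsets of Fl_(m+1), where i
   counts from 0.  The conditions determine G_j for j <= i (with j = k) and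
   for j > i+1 (with j = k+1); G_(i+1) is arbitrary. *)
Definition Pop (K : closedFieldType) (m : nat) (i : 'I_m)
    (Z : set (subspaces K m)) : set (subspaces K m.+1) :=
  let i' : 'I_m.+1 := widen_ord (leqnSn m) i in
  [set G | Fl K m.+1 G /\ exists2 F, Z F & forall k : 'I_m.+1,
     ((k <= i)%N -> G (widen_ord (leqnSn m.+1) k) = insert0 i' (F k)) /\
     ((i < k)%N -> G (lift ord0 k) =
                     (insert0 i' (F k) + <[(delta_mx i' 0)%R]>)%VS)].

Fixpoint growth_variety (K : closedFieldType) (s : growth) (m : nat) :
    set (subspaces K m.+1) :=
  if m is k.+1 then Pop (s k) (@growth_variety K s k) else Fl K 1.
Arguments growth_variety K s m : clear implicits.

(* X(T) for a tree T with m+1 leaves.  [growth_variety K s m] is the same for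
   all growth sequences s of T, so the union is just this common value. *)
Definition tree_variety (K : closedFieldType) (m : nat) (T : tree) :
    set (subspaces K m.+1) :=
  \bigcup_(s in [set s | grow s m = T]) growth_variety K s m.
Arguments tree_variety K m T : clear implicits.

(** * Catalan numbers *)

Definition catalan (n : nat) : nat := 'C(2 * n, n) %/ n.+1.

(* The division is exact. *)
Lemma catalanE (n : nat) : (n.+1 * catalan n)%N = 'C(2 * n, n).
Proof.
have := mul_bin_left (2 * n) n; rewrite mul2n -addnn addnK => E.
rewrite /catalan mul2n -addnn mulnC divnK //.
apply/dvdnP; exists ('C(n + n, n) - 'C(n + n, n.+1))%N.
by rewrite mulnC mulnBr E mulSn addnK.
Qed.

(* Main.v *)
From HB Require Import structures.
Require Import Defs.
From mathcomp Require Import all_boot all_order all_fingroup all_algebra.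
From mathcomp Require Import classical_sets functions cardinality reals.
From mathcomp Require Import complex.
From mathcomp Require Import boolp mpoly zify.

Set Implicit Arguments.
Unset Strict Implicit.
Unset Printing Implicit Defensive.

Import GRing.Theory.
Local Open Scope classical_set_scope.
Local Open Scope ring_scope.

(** Both families of subvarieties are described by linear conditions of two
    kinds on a flag G: either G_j lies in the hyperplane x_b = 0, or e_b lies
    in G_j ([constrained]).  Coordinates are counted from 0.

    Trees.  Number the internal nodes of T from left to right, so that node b
    separates the leaves b and b + 1, and let the leaves below node b be those
    in positions lo, ..., hi - 1.  The conditions attached to b are that G_lo
    lies in x_b = 0 and that e_b lies in G_hi.  Splitting leaf i creates a node
    i with lo = i and hi = i + 2 and shifts the other nodes; the operation P_i
    imposes exactly the two conditions of this new node and transports the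
    others along the insertion of a coordinate ([Pop_constrained]).  Hence
    X(T) is the set of flags satisfying the conditions of T, and depends on T
    only ([growth_varietyE]).

    Permutations.  Given w, read w b as the label of node b.  The conditions
    are that G_(p+1) lies in x_b = 0 whenever p < b and w p > w b, and that e_b
    lies in G_(q+1) whenever q > b and w q > w b.  These are the conditions of
    the decreasing binary tree of w.  No tree needs to be built from w, though:
    if i carries the smallest label, then deleting i from w undoes P_i
    ([Pop_perm]), and conversely a leaf can be split by inserting a smallest
    label ([growth_of_labels], [labels_of_growth]).

    The heart of the matter is that these conditions define w^-1 X_w^(w c)
    ([translated_richardsonE]).
    - The translated Richardson variety satisfies them.  The closure of a
      Schubert cell satisfies the usual rank inequalities, which say that
      certain minors vanish ([cell_closure_dim]).  Write E_{<=k} for the span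
      of the e_c with c <= k, and so on; let k = w b, and let F be the flag
      before translation, for which e_k takes the place of e_b.  When q > b and
      w q > k, the inequalities for F_(q+1) and for E_{<=k} and E_{>=k} add up
      to one more than q + 1, so that F_(q+1) contains e_k.  When
      p < b and w p > k, those for F_(p+1) and for E_{<k} and E_{>k} add up to
      p + 1, so that F_(p+1) is contained in the sum of these two coordinate
      spaces, which is the hyperplane x_k = 0.
    - Conversely, a flag satisfying them is a limit of flags in the open
      stratum.  Along P_i the flag is recovered from a smaller one by choosing
      a point of a projective line, and this point can be moved along a
      polynomial curve away from the two torus-fixed points.  By induction the
      flag is the value at 0 of a curve of matrices whose general value has a
      basis with leading terms prescribed by w and another one with leading
      terms prescribed by w c ([deformation]), that is, lies in both cells
      ([cell_lead], [opp_cell_lead]).  Closed sets contain such limits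
      ([closure_curve]).

    Finally, a general flag of X(T) contains e_b from G_hi on and not before
    ([generic_tree_flag]), and the numbers hi determine T ([node_hi_inj]), so
    different trees give different varieties; the trees are counted by the
    ballot recurrence for forests ([forest_enum]). *)

Local Notation mulv g := (linfun (@mulmx _ _ _ 1 g)).

(** * Spans of columns *)

Section Columns.
Variable K : fieldType.

Definition colspan m n (h : 'M[K]_(m, n)) (j : nat) : {vspace 'cV[K]_m} :=
  (\sum_(k < n | (k < j)%N) <[col k h]>)%VS.

Lemma mulvE m n (g : 'M[K]_(m, n)) (x : 'cV_n) : mulv g x = g *m x.
Proof. by rewrite lfunE. Qed.

Lemma mulv_comp m n p (g : 'M[K]_(m, n)) (h : 'M_(n, p))
    (V : {vspace 'cV[K]_p}) :
  (mulv g @: (mulv h @: V) = mulv (g *m h) @: V)%VS.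
Proof.
rewrite -limg_comp; apply: eq_in_limg => x _.
by rewrite comp_lfunE !mulvE mulmxA.
Qed.

Lemma mulv1 n (V : {vspace 'cV[K]_n}) : (mulv 1%:M @: V)%VS = V.
Proof.
rewrite -[RHS]lim1g; apply: eq_in_limg => x _.
by rewrite id_lfunE mulvE mul1mx.
Qed.

Lemma colspan0 m n (h : 'M[K]_(m, n)) : colspan h 0 = 0%VS.
Proof. by rewrite /colspan big_pred0. Qed.

Lemma colspanS m n (h : 'M[K]_(m, n)) (k : 'I_n) :
  colspan h k.+1 = (colspan h k + <[col k h]>)%VS.
Proof.
rewrite /colspan (bigD1 k) //= addvC; congr (_ + _)%VS.
by apply: eq_bigl => i; rewrite ltnS (ltn_neqAle i) andbC.
Qed.

Lemma colspan_img m n p (g : 'M[K]_(m, n)) (h : 'M_(n, p)) j :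
  (mulv g @: colspan h j)%VS = colspan (g *m h) j.
Proof.
rewrite /colspan limg_sum; apply: eq_bigr => k _.
by rewrite limg_line mulvE !colE mulmxA.
Qed.

Lemma colspan_mono m n (h : 'M[K]_(m, n)) i j :
  (i <= j)%N -> (colspan h i <= colspan h j)%VS.
Proof.
move=> ij; apply/subv_sumP => k ki; apply: (sumv_sup k) => //.
exact: leq_trans ki ij.
Qed.

Lemma mem_colspan m n (h : 'M[K]_(m, n)) (k : 'I_n) j :
  (k < j)%N -> col k h \in colspan h j.
Proof. by move=> kj; rewrite memvE; apply: (sumv_sup k). Qed.

Lemma dim_colspan_le m n (h : 'M[K]_(m, n)) j : (\dim (colspan h j) <= j)%N.
Proof.
elim: j => [|j IH]; first by rewrite colspan0 dimv0.
have [nj|jn] := leqP n j.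
  apply: leq_trans (leqW IH); apply: dimvS; apply/subv_sumP => k _.
  by rewrite -memvE mem_colspan // (leq_trans _ nj).
rewrite (colspanS _ (Ordinal jn)) /=.
apply: leq_trans (dimv_add_leqif _ _) _; rewrite dim_vline -[leqRHS]addn1.
by apply: leq_add => //; case: (_ != _).
Qed.

Lemma colspan_full m n (h : 'M[K]_(m, n)) : colspan h n = limg (mulv h).
Proof.
apply/eqP; rewrite eqEsubv; apply/andP; split.
  apply/subv_sumP => k _; rewrite -memvE; apply/memv_imgP.
  by exists (delta_mx k 0); rewrite ?memvf // mulvE colE.
apply/subvP => _ /memv_imgP[x _ ->]; rewrite mulvE.
suff -> : h *m x = \sum_k x k 0 *: col k h.
  by apply: memv_suml => k _; apply: memvZ; apply: mem_colspan.
apply/colP => i; rewrite mxE summxE; apply: eq_bigr => k _.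
by rewrite !mxE mulrC.
Qed.

Lemma dim_cV n : \dim {: 'cV[K]_n} = n.
Proof. by rewrite dimvf dim_matrix; lia. Qed.

Lemma dim_limg_mulmx m n (M : 'M[K]_(m, n)) :
  \dim (limg (mulv M)) = \rank M.
Proof.
have -> : mulv M =
    (mulv (col_base M) \o mulv (row_base M))%VF.
  by apply/lfunP => x; rewrite comp_lfunE !mulvE mulmxA mulmx_base.
rewrite limg_comp.
have -> : limg (mulv (row_base M)) = fullv.
  apply/eqP; rewrite eqEsubv subvf /=; apply/subvP => x _.
  apply/memv_imgP; exists (pinvmx (row_base M) *m x); first by rewrite memvf.
  by rewrite mulvE mulmxA mulmxVp ?row_base_free // mul1mx.
rewrite limg_dim_eq ?dim_cV //; apply/eqP; rewrite -subv0.
apply/subvP => x /memv_capP[_]; rewrite memv_ker memv0 mulvE => /eqP E.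
rewrite -(mul1mx x) -(mulVpmx (col_base_full M)) -mulmxA E mulmx0 //.
Qed.

Lemma addv_line_eq (vT : vectType K) (U V : {vspace vT}) v :
    (U <= V)%VS -> \dim V = (\dim U).+1 -> v \in V -> v \notin U ->
  V = (U + <[v]>)%VS.
Proof.
move=> UV dV vV vU; apply/eqP; rewrite eq_sym eqEdim.
rewrite subv_add UV -memvE vV /= dV dimv_disjoint_sum.
  rewrite dim_vline; case: eqVneq vU => [->|_ _]; rewrite ?mem0v //.
  by rewrite addn1.
apply/eqP; rewrite -subv0; apply/subvP => x /memv_capP[xU /vlineP[c xc]].
rewrite memv0 xc scaler_eq0; apply: contraR vU; rewrite negb_or.
case/andP => c0 _; rewrite xc in xU.
by have := memvZ c^-1 xU; rewrite scalerA mulVf // scale1r.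
Qed.

End Columns.

(** * Flags indexed by natural numbers *)

Section FlagBasics.
Variable K : closedFieldType.

(** Subspaces are read at natural numbers, which keeps casts between ordinals
    of different bounds out of the arguments where flags of different sizes are
    compared. *)
Definition subsp n (F : subspaces K n) (j : nat) : {vspace 'cV[K]_n} :=
  F (inord j).

Lemma subsp_ext n (F G : subspaces K n) :
  (forall j, (j <= n)%N -> subsp F j = subsp G j) -> F = G.
Proof.
move=> FG; apply/ffunP => j; have := FG j (ltn_ord j).
by rewrite /subsp inord_val.
Qed.

Lemma subsp_flag n (h : 'M[K]_n) j :
  (j <= n)%N -> subsp (flag_of_mx h) j = colspan h j.
Proof. by move=> jn; rewrite /subsp ffunE inordK. Qed.

Lemma subsp_act n (g : 'M[K]_n) (F : subspaces K n) j :
  subsp (mx_act g F) j = (mulv g @: subsp F j)%VS.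
Proof. by rewrite /subsp ffunE. Qed.

Lemma Fl_dim n (F : subspaces K n) j :
  Fl K n F -> (j <= n)%N -> \dim (subsp F j) = j.
Proof. by case=> dF _ jn; rewrite dF inordK. Qed.

Lemma Fl_mono n (F : subspaces K n) i j :
  Fl K n F -> (i <= j <= n)%N -> (subsp F i <= subsp F j)%VS.
Proof.
by case=> _ mF /andP[ij jn]; apply: mF; rewrite !inordK // ltnS (leq_trans ij).
Qed.

Lemma Fl_intro n (F : subspaces K n) :
    (forall j, (j <= n)%N -> \dim (subsp F j) = j) ->
    (forall j, (j < n)%N -> (subsp F j <= subsp F j.+1)%VS) ->
  Fl K n F.
Proof.
move=> dF mF; split=> [j|i j ij].
  by have := dF j (ltn_ord j); rewrite /subsp inord_val.
have mono d : (i + d <= n)%N -> (subsp F i <= subsp F (i + d))%VS.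
  elim: d => [|d IH]; first by rewrite addn0 subvv.
  rewrite addnS => idn; apply: subv_trans (mF _ idn).
  by apply: IH; exact: ltnW.
have := mono (j - i)%N; rewrite subnKC // => /(_ (ltn_ord j)).
by rewrite /subsp !inord_val.
Qed.

Lemma Fl_full n (F : subspaces K n) : Fl K n F -> subsp F n = fullv.
Proof.
move=> /Fl_dim/(_ (leqnn n)) dF.
by apply/eqP; rewrite eqEdim subvf dim_cV dF leqnn.
Qed.

Lemma Fl0 n (F : subspaces K n) : Fl K n F -> subsp F 0 = 0%VS.
Proof. by move=> /Fl_dim/(_ (leq0n n)) /eqP; rewrite dimv_eq0 => /eqP. Qed.

Lemma dim_colspan n (h : 'M[K]_n) j :
  h \in unitmx -> (j <= n)%N -> \dim (colspan h j) = j.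
Proof.
move=> hu jn.
have drop d : (d <= n)%N -> (n - d <= \dim (colspan h (n - d)))%N.
  elim: d => [|d IH] dn.
    by rewrite subn0 colspan_full dim_limg_mulmx mxrank_unit.
  have kn : (n - d.+1 < n)%N by rewrite ltn_subrL (leq_trans _ dn).
  have := colspanS h (Ordinal kn); rewrite /= subnSK // => E.
  have := IH (ltnW dn); rewrite E => /leq_trans/(_ (dimv_add_leqif _ _)).
  rewrite dim_vline; case: (_ != _) => /=; lia.
apply/eqP; rewrite eqn_leq dim_colspan_le /=.
by have := drop (n - j)%N (leq_subr _ _); rewrite subKn.
Qed.

Lemma Fl_flag_of_mx n (h : 'M[K]_n) : h \in unitmx -> Fl K n (flag_of_mx h).
Proof.
move=> hu; apply: Fl_intro => j jn; rewrite !subsp_flag ?(ltnW jn) //.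
  exact: dim_colspan.
exact: colspan_mono.
Qed.

Lemma unitmx_colspan n (h : 'M[K]_n) : \dim (colspan h n) = n -> h \in unitmx.
Proof.
by rewrite colspan_full dim_limg_mulmx -row_free_unit /row_free => ->.
Qed.

Lemma Fl_unitmx n (h : 'M[K]_n) : Fl K n (flag_of_mx h) -> h \in unitmx.
Proof.
by move=> Fh; apply: unitmx_colspan; rewrite -subsp_flag // Fl_dim.
Qed.

Lemma Fl_mx n (F : subspaces K n) :
  Fl K n F -> exists2 h : 'M[K]_n, h \in unitmx & F = flag_of_mx h.
Proof.
move=> FF.
have step (k : 'I_n) :
    exists v : 'cV[K]_n, subsp F k.+1 = (subsp F k + <[v]>)%VS.
  have : ~~ (subsp F k.+1 <= subsp F k)%VS.
    by apply/negP => /dimvS; rewrite !Fl_dim ?ltnn // ltnW.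
  case/subvPn => v vF vk; exists v; apply: addv_line_eq => //.
    by apply: Fl_mono => //; rewrite leqnSn /=.
  by rewrite !Fl_dim // ltnW.
have [v Hv] := choice step.
pose h : 'M[K]_n := \matrix_(i, j) v j i 0.
have colh k : col k h = v k by apply/colP => i; rewrite !mxE.
have E : F = flag_of_mx h.
  apply: subsp_ext => j; elim: j => [|j IH] jn.
    by rewrite subsp_flag // colspan0 Fl0.
  have := Hv (Ordinal jn); rewrite /= => ->; rewrite IH ?(ltnW jn) //.
  rewrite !subsp_flag ?(ltnW jn) //.
  by have := colspanS h (Ordinal jn); rewrite colh => ->.
by exists h => //; apply: Fl_unitmx; rewrite -E.
Qed.

Lemma mx_act_flag n (g h : 'M[K]_n) :
  mx_act g (flag_of_mx h) = flag_of_mx (g *m h).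
Proof. by apply/ffunP => j; rewrite !ffunE colspan_img. Qed.

Lemma mx_act_comp n (g h : 'M[K]_n) F :
  mx_act g (mx_act h F) = mx_act (g *m h) F.
Proof. by apply/ffunP => j; rewrite !ffunE mulv_comp. Qed.

Lemma mx_act1 n (F : subspaces K n) : mx_act 1%:M F = F.
Proof. by apply/ffunP => j; rewrite !ffunE mulv1. Qed.

Lemma Fl_act n (g : 'M[K]_n) F :
  g \in unitmx -> Fl K n F -> Fl K n (mx_act g F).
Proof.
move=> gu /Fl_mx[h hu ->]; rewrite mx_act_flag; apply: Fl_flag_of_mx.
by rewrite unitmx_mul gu.
Qed.

End FlagBasics.

(** * Closed sets of flags *)

Section Zariski.
Variable K : closedFieldType.

Lemma row_free_rowsub m n p (w : 'I_p -> 'I_m) (A : 'M[K]_(m, n)) :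
  injective w -> row_free A -> row_free (rowsub w A).
Proof.
move=> w_inj /row_freeP[B AB]; apply/row_freeP.
exists (B *m (rowsub w 1%:M)^T).
rewrite mulmxA mul_rowsub_mx AB; apply/matrixP => i j.
rewrite !mxE (bigD1 (w i)) //= big1 => [|k /negbTE ki]; last first.
  by rewrite !mxE eq_sym ki mul0r.
by rewrite !mxE eqxx mul1r addr0 (inj_eq w_inj) eq_sym.
Qed.

(** The rows of a submatrix of maximal rank are independent, hence so are r + 1
    of them, and the same choice can then be made among the columns. *)
Lemma rank_minorsP m n (M : 'M[K]_(m, n)) r :
  (\rank M <= r)%N <->
  forall (f : 'I_r.+1 -> 'I_m) (g : 'I_r.+1 -> 'I_n), \det (mxsub f g M) = 0.
Proof.
split=> [rk f g|minors].
  have rkfg : (\rank (mxsub f g M) <= r)%N.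
    apply: leq_trans rk.
    have -> : mxsub f g M = rowsub f 1%:M *m M *m colsub g 1%:M.
      by rewrite mul_rowsub_mx mul1mx mulmx_colsub mulmx1 -mxsubcr.
    exact: leq_trans (mxrankM_maxl _ _) (mxrankM_maxr _ _).
  apply/eqP; apply: contraLR rkfg => dn0.
  by rewrite mxrank_unit ?unitmxE ?unitfE // -ltnNge.
rewrite leqNgt; apply/negP => rk.
pose f := maxrankfun M \o widen_ord rk.
have free1 : row_free (rowsub f M).
  have -> : rowsub f M = rowsub (widen_ord rk) (rowsub (maxrankfun M) M).
    by rewrite -rowsub_comp.
  apply: row_free_rowsub (maxrowsub_free M).
  by move=> i j /(congr1 val) /= ij; apply: val_inj.
have full1 : row_full (rowsub f M)^T by rewrite /row_full mxrank_tr.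
have := fullrowsub_unit full1; set g := fullrankfun full1.
rewrite unitmxE -det_tr.
have -> : (rowsub g (rowsub f M)^T)^T = mxsub f g M.
  by apply/matrixP => i j; rewrite !mxE.
by rewrite minors unitr0.
Qed.

Definition trunc_cols (R : pzRingType) m n (h : 'M[R]_(m, n)) (j : nat) :
  'M[R]_(m, n) := \matrix_(i, k) (if (k < j)%N then h i k else 0).

Lemma colspan_trunc m n (h : 'M[K]_(m, n)) j :
  colspan h j = limg (mulv (trunc_cols h j)).
Proof.
rewrite -colspan_full /colspan big_mkcond [RHS]big_mkcond.
apply: eq_bigr => k _; rewrite ltn_ord.
have -> : col k (trunc_cols h j) = if (k < j)%N then col k h else 0.
  by apply/colP => i; case: ifP => kj; rewrite !mxE kj.
by case: ifP => // _; apply/esym/eqP; rewrite -dimv_eq0 dim_vline eqxx.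
Qed.

(** This covers the Schubert conditions on F_j: with g a coordinate projection,
    the dimension bounded here is the rank of a block of the matrix, and the
    bound is the vanishing of its minors of size r + 1. *)
Lemma rank_locus_closed n (g : 'M[K]_n) j r : (j <= n)%N ->
  Fl_closed [set F : subspaces K n |
    Fl K n F /\ (\dim (mulv g @: subsp F j) <= r)%N].
Proof.
move=> jn; split=> [F []//|].
pose X : 'M[{mpoly K[n * n]}]_n := \matrix_(i, k) 'X_(mxvec_index i k).
pose M := map_mx (@mpolyC (n * n) K) g *m trunc_cols X j.
exists [set p | exists f k : 'I_r.+1 -> 'I_n, p = \det (mxsub f k M)] => h hu.
have evalM f k : (\det (mxsub f k M)).@[fun i => mxvec h 0 i] =
                 \det (mxsub f k (g *m trunc_cols h j)) :> K.
  rewrite -(det_map_mx (meval (fun i => mxvec h 0 i))) map_mxsub.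
  congr (\det (mxsub _ _ _)); rewrite map_mxM; congr (_ *m _).
    by apply/matrixP => a b; rewrite !mxE /= mevalC.
  apply/matrixP => a b; rewrite !mxE; case: ifP => _; last exact: meval0.
  by rewrite /= mevalXU mxvecE.
have rankE : \dim (mulv g @: subsp (flag_of_mx h) j) =
             \rank (g *m trunc_cols h j).
  by rewrite subsp_flag // colspan_trunc mulv_comp dim_limg_mulmx.
rewrite /= rankE; split=> [[_ /rank_minorsP minors] p [f [k ->]]|minors].
  by rewrite evalM.
split; first exact: Fl_flag_of_mx.
by apply/rank_minorsP => f k; rewrite -evalM; apply: minors; exists f, k.
Qed.

(** A polynomial that vanishes on the closed set, evaluated along the curve, is
    a polynomial in t that vanishes at all but finitely many t, hence at 0.
    This replaces the irreducibility argument by which a dense part of a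
    variety determines its closure. *)
Lemma closure_curve n (A : set (subspaces K n)) (h : 'M[{poly K}]_n)
    (q : {poly K}) :
    q != 0 -> map_mx (horner_eval 0) h \in unitmx ->
    (forall t, q.[t] != 0 -> A (flag_of_mx (map_mx (horner_eval t) h))) ->
  Fl_closure A (flag_of_mx (map_mx (horner_eval 0) h)).
Proof.
move=> q0 h0u Ah Z [[ZF [S HS]] AZ].
have det0 : \det h != 0.
  apply: contraTneq h0u => d0.
  by rewrite unitmxE (det_map_mx (horner_eval 0)) d0 rmorph0 unitr0.
apply/(HS _ h0u) => p Sp.
pose P := mmap (@polyC K) (fun k => mxvec h 0 k) p.
have evalP t : P.[t] = p.@[fun k => mxvec (map_mx (horner_eval t) h) 0 k].
  rewrite /P /mmap horner_sum mevalE; apply: eq_bigr => m _.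
  rewrite hornerM hornerC; congr (_ * _); rewrite /mmap1 horner_prod.
  apply: eq_bigr => k _; rewrite horner_exp; congr (_ ^+ _).
  by rewrite -map_mxvec mxE.
rewrite -evalP.
suff -> : P = 0 by rewrite horner0.
apply/eqP; apply: contraT => P0.
have : P * (q * \det h) != 0 by rewrite !mulf_neq0.
case/closed_nonrootP => t; rewrite /root !hornerM !mulf_eq0 !negb_or.
case/and3P => Pt qt dt; have := Ah t qt.
have htu : map_mx (horner_eval t) h \in unitmx.
  by rewrite unitmxE (det_map_mx (horner_eval t)) unitfE.
move=> /AZ /(HS _ htu)/(_ p Sp) /eqP; rewrite -evalP.
by rewrite (negbTE Pt).
Qed.

End Zariski.

(** * Schubert cells and their closures *)

Section Cells.
Variable K : closedFieldType.

Lemma flag_of_mx_borel n (h b : 'M[K]_n) :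
  h \in unitmx -> borel K n b -> flag_of_mx (h *m b) = flag_of_mx h.
Proof.
move=> hu [bu /is_trig_mxP bt]; apply: subsp_ext => j jn.
rewrite !subsp_flag //; apply/eqP; rewrite eqEdim.
rewrite !dim_colspan ?unitmx_mul ?hu // leqnn andbT.
apply/subv_sumP => k kj; rewrite -memvE.
have -> : col k (h *m b) = \sum_l b l k *: col l h.
  apply/colP => i; rewrite !mxE summxE; apply: eq_bigr => l _.
  by rewrite !mxE mulrC.
apply: memv_suml => l _; have [lk|kl] := leqP l k.
  by apply/memvZ/mem_colspan/(leq_ltn_trans lk).
by have := bt k l kl; rewrite mxE => ->; rewrite scale0r mem0v.
Qed.

Lemma trig_unitmx n (b : 'M[K]_n) :
  is_trig_mx b -> (forall i, b i i != 0) -> b \in unitmx.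
Proof.
by move=> bt b0; rewrite unitmxE det_trig // unitfE; apply/prodf_neq0 => i _.
Qed.

Lemma perm_matrixV n (w : 'S_n) :
  perm_matrix K w^-1%g *m perm_matrix K w = 1%:M.
Proof.
apply/matrixP => x y; rewrite !mxE (bigD1 (w y)) //= big1 => [|l /negbTE lva].
  by rewrite !mxE eqxx mulr1 addr0 permK.
by rewrite [X in _ * X]mxE lva mulr0.
Qed.

Lemma perm_matrix_unit n (w : 'S_n) : perm_matrix K w \in unitmx.
Proof. by have [] := mulmx1_unit (perm_matrixV w). Qed.

Lemma perm_matrix_mul n p (w : 'S_n) (B : 'M[K]_(n, p)) x y :
  (perm_matrix K w *m B) x y = B (w^-1%g x) y.
Proof.
rewrite mxE (bigD1 (w^-1%g x)) //= big1 => [|l].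
  by rewrite mxE permKV eqxx mul1r addr0.
rewrite [X in X * _]mxE; case: (x =P w l) => [->|_ _]; last by rewrite mul0r.
by rewrite permK eqxx.
Qed.

Definition coordsp n (S : pred 'I_n) : {vspace 'cV[K]_n} :=
  lker (mulv (diag_mx (\row_c (~~ S c)%:R))).

Lemma coordspP n (S : pred 'I_n) (x : 'cV[K]_n) :
  reflect (forall c, ~~ S c -> x c 0 = 0) (x \in coordsp S).
Proof.
rewrite memv_ker mulvE mul_diag_mx; apply: (iffP eqP) => [E c Sc|E].
  by have := congr1 (fun M : 'cV_n => M c 0) E; rewrite !mxE Sc mul1r.
apply/colP => c; rewrite !mxE; case: (boolP (S c)) => [_|/E ->].
  by rewrite mul0r.
by rewrite mulr0.
Qed.

Lemma card_ord_lt n j : (j <= n)%N -> #|[pred a : 'I_n | (a < j)%N]| = j.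
Proof.
move=> jn; rewrite -sum1_card (eq_bigl (fun a : 'I_n => (a < j)%N)) //.
by rewrite (big_ord_narrow jn) sum1_card card_ord.
Qed.

(** The Schubert inequality. The group H preserves the coordinate subspace of
    S, so the projection along it kills those of the first j columns of b v
    whose index a has v a in S. This bounds the dimension of the projection of
    F_j on the cell, hence on its closure, and the kernel has the complementary
    dimension. *)
Lemma cell_closure_dim n (H : set 'M[K]_n) (v : 'S_n) (S : pred 'I_n) F j :
    (forall b, H b ->
       b \in unitmx /\ forall c d, S c -> ~~ S d -> b d c = 0) ->
    (j <= n)%N -> Fl_closure (cell H v) F ->
  Fl K n F /\
  (#|[pred a : 'I_n | (a < j)%N && S (v a)]| <=
     \dim (subsp F j :&: coordsp S))%N.
Proof.
move=> HS jn; set r := #|[pred a : 'I_n | (a < j)%N && ~~ S (v a)]|.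
pose mask : 'M[K]_n := diag_mx (\row_c (~~ S c)%:R).
have card : (#|[pred a : 'I_n | (a < j)%N && S (v a)]| + r = j)%N.
  rewrite /r; set P := (X in (#|X| + _)%N); set Q := (X in (_ + #|X|)%N).
  rewrite -(card_ord_lt jn).
  rewrite -[RHS](cardID [pred a | S (v a)]); congr (_ + _)%N.
    by apply: eq_card => a; rewrite !inE andbC.
move=> clF; have := smallest_sub (rank_locus_closed mask r jn) _ clF.
case=> [_ [h [b [Hh bb ->]]]|FF rk].
  have [hu hS] := HS _ Hh.
  have Pu := perm_matrix_unit v.
  split; first by apply: Fl_flag_of_mx; rewrite !unitmx_mul hu Pu bb.1.
  rewrite flag_of_mx_borel ?unitmx_mul ?hu // subsp_flag // colspan_img.
  apply: (@leq_trans (\sum_(a < n | (a < j)%N && ~~ S (v a)) 1)); last first.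
    by rewrite sum1_card.
  apply: leq_trans (dimv_leq_sum _ _ _) _; rewrite big_mkcondr.
  apply: leq_sum => a aj; rewrite dim_vline.
  case: ifP => [_|/negbFE Sva]; first by case: (_ != _).
  suff -> : col a (mask *m (h *m perm_matrix K v)) = 0 by rewrite eqxx.
  apply/colP => d; rewrite mul_diag_mx !mxE.
  have -> : \sum_l h d l * perm_matrix K v l a = h d (v a).
    rewrite (bigD1 (v a)) //= big1 => [|l /negbTE lva].
      by rewrite mxE eqxx mulr1 addr0.
    by rewrite mxE lva mulr0.
  case: (boolP (S d)) => Sd; first by rewrite mul0r.
  by rewrite hS // mulr0.
split=> //; have := limg_ker_dim (mulv mask) (subsp F j).
rewrite Fl_dim // -/(coordsp S) -[in RHS]card => E.
by rewrite -(leq_add2r r) -E leq_add2l.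
Qed.

Lemma lead_factor n (w u : 'S_n) (B : 'M[K]_n) :
  perm_matrix K w *m B =
  \matrix_(x, y) B (w^-1%g x) (u^-1%g y) *m perm_matrix K u *m 1%:M.
Proof.
apply/matrixP => x y; rewrite perm_matrix_mul mulmx1 mxE.
rewrite (bigD1 (u y)) //= big1 => [|l /negbTE lva].
  by rewrite !mxE eqxx mulr1 addr0 permK.
by rewrite [X in _ * X]mxE lva mulr0.
Qed.

Lemma borel1 n : borel K n 1%:M.
Proof.
split; first exact: unitmx1.
by rewrite trmx1; apply/is_trig_mxP => i j ij; rewrite mxE -val_eqE ltn_eqF.
Qed.

(** If the j-th column of B involves e_a with w a = u j and otherwise only
    larger labels w a, then relabelling the coordinates by w makes the matrix
    lower triangular after its columns are sorted by u. *)
Lemma opp_cell_lead n (w u : 'S_n) (B : 'M[K]_n) :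
    (forall a j, (w a < u j)%N -> B a j = 0) ->
    (forall a j, w a = u j -> B a j != 0) ->
  cell (opp_borel K n) u (flag_of_mx (perm_matrix K w *m B)).
Proof.
move=> B0 Bn0; rewrite (lead_factor w u).
set M := (X in X *m _ *m _); have trigM : is_trig_mx M.
  by apply/is_trig_mxP => x y xy; rewrite mxE B0 // !permKV.
exists M, 1%:M; split; [split=> // | exact: borel1 | by []].
by apply: trig_unitmx => // x; rewrite mxE Bn0 // !permKV.
Qed.

Lemma cell_lead n (w u : 'S_n) (B : 'M[K]_n) :
    (forall a j, (u j < w a)%N -> B a j = 0) ->
    (forall a j, w a = u j -> B a j != 0) ->
  cell (borel K n) u (flag_of_mx (perm_matrix K w *m B)).
Proof.
move=> B0 Bn0; rewrite (lead_factor w u).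
set M := (X in X *m _ *m _); have trigM : is_trig_mx M^T.
  by apply/is_trig_mxP => x y xy; rewrite !mxE B0 // !permKV.
exists M, 1%:M; split; [split=> // | exact: borel1 | by []].
by rewrite -unitmx_tr; apply: trig_unitmx => // x; rewrite !mxE Bn0 // !permKV.
Qed.

End Cells.

(** * Linear conditions and the operations P_i *)

Section Pop.
Variable K : closedFieldType.

Section Insert.
Variables (m : nat) (i : 'I_m.+1).
Local Notation I := (insert0_mx K i).

Lemma insert0_lift p (x : 'M[K]_(m, p)) l k : (I *m x) (lift i l) k = x l k.
Proof.
rewrite mxE (bigD1 l) //= big1 => [|a /negbTE al].
  by rewrite mxE eqxx mul1r addr0.
by rewrite mxE (inj_eq lift_inj) eq_sym al mul0r.
Qed.

Lemma insert0_at p (x : 'M[K]_(m, p)) k : (I *m x) i k = 0.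
Proof.
rewrite mxE big1 // => a _.
by rewrite mxE (negbTE (neq_lift _ _)) mul0r.
Qed.

Lemma tr_insert0E p (y : 'M[K]_(m.+1, p)) l k : (I^T *m y) l k = y (lift i l) k.
Proof.
rewrite mxE (bigD1 (lift i l)) //= big1 => [|a /negbTE al].
  by rewrite !mxE eqxx mul1r addr0.
by rewrite !mxE al mul0r.
Qed.

Lemma tr_insert0K p (x : 'M[K]_(m, p)) : I^T *m (I *m x) = x.
Proof. by apply/matrixP => l k; rewrite tr_insert0E insert0_lift. Qed.

Lemma tr_insert0_delta : I^T *m delta_mx i 0 = 0 :> 'cV_m.
Proof.
apply/colP => l; rewrite tr_insert0E !mxE eq_sym.
by rewrite (negbTE (neq_lift _ _)).
Qed.

Lemma insert0_delta l :
  I *m delta_mx l 0 = delta_mx (lift i l) 0 :> 'cV_m.+1.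
Proof.
apply/colP => a; case: (unliftP i a) => [b|] ->.
  by rewrite insert0_lift !mxE (inj_eq lift_inj).
by rewrite insert0_at !mxE (negbTE (neq_lift _ _)).
Qed.

Lemma insert0_trK (y : 'cV[K]_m.+1) :
  I *m (I^T *m y) + y i 0 *: delta_mx i 0 = y.
Proof.
apply/colP => a; rewrite mxE; case: (unliftP i a) => [b|] ->.
  rewrite insert0_lift tr_insert0E !mxE eq_sym (negbTE (neq_lift _ _)).
  by rewrite mulr0 addr0.
by rewrite insert0_at !mxE !eqxx mulr1 add0r.
Qed.

Lemma mem_insert0 (V : {vspace 'cV[K]_m}) (y : 'cV_m.+1) :
  (y \in insert0 i V) = (y i 0 == 0) && (I^T *m y \in V).
Proof.
apply/idP/andP => [/memv_imgP[x xV ->]|[/eqP y0 yV]].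
  by rewrite mulvE insert0_at tr_insert0K.
apply/memv_imgP; exists (I^T *m y) => //.
by rewrite mulvE -[LHS]insert0_trK y0 scale0r addr0.
Qed.

Lemma mem_insert0_add (V : {vspace 'cV[K]_m}) (y : 'cV_m.+1) :
  (y \in (insert0 i V + <[(delta_mx i 0)%R]>)%VS) = (I^T *m y \in V).
Proof.
apply/idP/idP => [/memv_addP[u uV [_ /vlineP[c ->] ->]]|yV].
  rewrite mulmxDr -scalemxAr tr_insert0_delta scaler0 addr0.
  by move: uV; rewrite mem_insert0 => /andP[].
rewrite -(insert0_trK y); apply: memv_add; last exact/memvZ/memv_line.
by rewrite mem_insert0 insert0_at eqxx tr_insert0K.
Qed.

Lemma dim_insert0 (V : {vspace 'cV[K]_m}) : \dim (insert0 i V) = \dim V.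
Proof.
apply: limg_dim_eq; apply/eqP; rewrite -subv0; apply/subvP => x.
case/memv_capP => _; rewrite memv_ker memv0 mulvE => /eqP x0.
by rewrite -(tr_insert0K x) x0 mulmx0.
Qed.

Lemma dim_insert0_add (V : {vspace 'cV[K]_m}) :
  \dim (insert0 i V + <[(delta_mx i 0)%R]>) = (\dim V).+1.
Proof.
rewrite dimv_disjoint_sum.
  rewrite dim_insert0 dim_vline; case: eqP => [/colP/(_ i)|_].
    by rewrite !mxE !eqxx => /eqP; rewrite oner_eq0.
  by rewrite addn1.
apply/eqP; rewrite -subv0; apply/subvP => y /memv_capP[+ /vlineP[c yc]].
rewrite mem_insert0 memv0 yc !mxE !eqxx mulr1 => /andP[/eqP -> _].
by rewrite scale0r.
Qed.

End Insert.

Section PopStep.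
Variables (m : nat) (i : 'I_m).
Local Notation i' := (widen_ord (leqnSn m) i).
Local Notation e_i := (delta_mx i' 0 : 'cV[K]_m.+1).

(** G lies over F for the operation P_i, whatever its space in position i + 1.
    *)
Definition pop_rel (F : subspaces K m) (G : subspaces K m.+1) : Prop :=
  (forall j, (j <= i)%N -> subsp G j = insert0 i' (subsp F j)) /\
  (forall j, (i < j <= m)%N ->
     subsp G j.+1 = (insert0 i' (subsp F j) + <[e_i]>)%VS).

Lemma PopP Z G : Pop i Z G <-> Fl K m.+1 G /\ exists2 F, Z F & pop_rel F G.
Proof.
have lt_im : (i < m)%N by [].
split=> -[FG [F ZF FG_]]; split=> //; exists F => //.
  split=> j => [ji|/andP[ij jm]].
    have jm : (j < m.+1)%N by lia.
    have [/(_ ji) + _] := FG_ (Ordinal jm).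
    rewrite /subsp (_ : Ordinal jm = inord j); last first.
      by apply: val_inj; rewrite /= inordK.
    move=> <-; congr (G _); apply: val_inj => /=.
    by rewrite !inordK //; lia.
  have [_ /(_ ij)] := FG_ (Ordinal (jm : (j < m.+1)%N)).
  rewrite /subsp (_ : Ordinal _ = inord j); last first.
    by apply: val_inj; rewrite /= inordK.
  move=> <-; congr (G _); apply: val_inj => /=.
  by rewrite !inordK //; lia.
case: FG_ => lo hi k; have km := ltn_ord k; split=> ki.
  have := lo k ki; rewrite /subsp inord_val => <-.
  by congr (G _); apply: val_inj; rewrite /= inordK //; lia.
have := hi k; rewrite ki -ltnS km => /(_ isT); rewrite /subsp inord_val => <-.
by congr (G _); apply: val_inj; rewrite /= /bump inordK //; lia.
Qed.

End PopStep.

Definition constrained n (L H : nat -> nat -> Prop) : set (subspaces K n) :=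
  [set G | Fl K n G /\ forall j (b : 'I_n), (j <= n)%N ->
     (L j b -> forall v, v \in subsp G j -> v b 0 = 0) /\
     (H j b -> delta_mx b 0 \in subsp G j)].

(** The hypotheses say that in L and H, the new coordinate i has as its
    strictest conditions those built into P_i, that nothing is asked of the
    space in position i + 1, which P_i leaves free, and that the other
    conditions are those of L' and H'. The index of the space is shifted from i
    + 1 on and that of the coordinate from i on, which explains the two bumps.
    From G the smaller flag is recovered by pulling its spaces back along the
    insertion of a zero. *)
Lemma Pop_constrained m (i : 'I_m) (L H L' H' : nat -> nat -> Prop) :
    (forall j b, (j <= m)%N -> (b < m)%N ->
       (L (bump i.+1 j) (bump i b) <-> L' j b) /\
       (H (bump i.+1 j) (bump i b) <-> H' j b)) ->
    (forall b : nat, (b <= m)%N -> b != i -> ~ L i.+1 b /\ ~ H i.+1 b) ->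
    (forall j, L j i -> (j <= i)%N) -> ((0 < i)%N -> L i i) ->
    (forall j, H j i -> (i.+1 < j)%N) -> H i.+2 i ->
  Pop i (constrained (n := m) L' H') = constrained (n := m.+1) L H.
Proof.
move=> LH LHi Li1 Li2 Hi1 Hi2.
pose i' := widen_ord (leqnSn m) i.
have im : (i < m)%N := ltn_ord i.
apply/seteqP; split=> G; rewrite PopP.
  move=> [FG [F [FF CF] [+ +]]]; rewrite -/i' => lo hi; split=> // j b jm.
  have memG j' v : (j' <= m)%N -> (v \in subsp G (bump i.+1 j')) =
      ((insert0_mx K i')^T *m v \in subsp F j') &&
      ((j' <= i)%N ==> (v i' 0 == 0)).
    move=> j'm; rewrite /bump; have [ij|ji] := ltnP i j'.
      by rewrite add1n hi ?ij // mem_insert0_add andbT.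
    by rewrite add0n lo // mem_insert0 andbC.
  have [-> | [j' [jE j'm]]] :
      j = i.+1 \/ exists j', j = bump i.+1 j' /\ (j' <= m)%N.
  - have [ij|ij|] := ltngtP j i.+1; [right|right|by left].
      by exists j; rewrite /bump; lia.
    by exists j.-1; rewrite /bump; lia.
  - have [bi|bi] := eqVneq (b : nat) i; last by have [] := LHi b (ltn_ord b) bi.
    by rewrite bi; split=> [/Li1|/Hi1]; rewrite ltnn.
  rewrite {}jE in jm *; case: (unliftP i' b) => [b0|] -> /=.
    have [LL' HH'] := LH j' b0 j'm (ltn_ord b0).
    have [CL CH] := CF j' b0 j'm; split=> [/LL' /CL x0 v|/HH' /CH eF].
      by rewrite memG // => /andP[/x0 + _]; rewrite tr_insert0E.
    rewrite memG // -insert0_delta tr_insert0K eF insert0_at eqxx.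
    by rewrite implybT.
  split=> [/Li1 ji v|/Hi1 ij].
    have j'i : (j' <= i)%N by move: ji; rewrite /bump; lia.
    by rewrite memG // j'i => /andP[_ /eqP].
  have ij' : (i < j')%N by move: ij; rewrite /bump; lia.
  by rewrite memG // leqNgt ij' tr_insert0_delta mem0v.
move=> [FG CG]; split=> //.
have e_in j : (i < j <= m)%N -> delta_mx i' 0 \in subsp G j.+1.
  move=> /andP[ij jm]; have [_ /(_ Hi2)] := CG i.+2 i' ltac:(lia).
  by apply/subvP/Fl_mono => //; lia.
have x_in j v : (j <= i)%N -> v \in subsp G j -> v i' 0 = 0.
  move=> ji; have [i0|i0] := posnP i; last first.
    have [/(_ (Li2 i0)) L0 _] := CG i i' ltac:(lia).
    by move=> vj; apply: L0; move: vj; apply/subvP/Fl_mono => //; lia.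
  have -> : j = 0%N by lia.
  by rewrite Fl0 // memv0 => /eqP ->; rewrite mxE.
pose F : subspaces K m :=
  [ffun k : 'I_m.+1 => (mulv (insert0_mx K i') @^-1: subsp G (bump i.+1 k))%VS].
have memF j x : (j <= m)%N ->
    (x \in subsp F j) = (insert0_mx K i' *m x \in subsp G (bump i.+1 j)).
  by move=> jm; rewrite /subsp ffunE inordK // -memv_preim mulvE.
have lo j : (j <= i)%N -> subsp G j = insert0 i' (subsp F j).
  move=> ji; apply/vspaceP => y; rewrite mem_insert0 memF; last by lia.
  rewrite (_ : bump _ _ = j); last by rewrite /bump; lia.
  have := insert0_trK i' y.
  case: (y i' 0 =P 0) => [-> /=|yi]; first by rewrite scale0r addr0 => ->.
  by move=> _; apply/negP => /(x_in _ _ ji).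
have hi j : (i < j <= m)%N ->
    subsp G j.+1 = (insert0 i' (subsp F j) + <[(delta_mx i' 0)%R]>)%VS.
  move=> ijm; have ei := e_in j ijm; case/andP: ijm => ij jm.
  apply/vspaceP => y; rewrite mem_insert0_add memF //.
  rewrite (_ : bump _ _ = j.+1); last by rewrite /bump; lia.
  rewrite -{1}(insert0_trK i' y); apply/idP/idP => yG.
    by rewrite -[_ *m _](addrK (y i' 0 *: delta_mx i' 0)) memvB // memvZ.
  by rewrite memvD // memvZ.
exists F; last by split.
split=> [|j b jm]; last first.
  have [LL' HH'] := LH j b jm (ltn_ord b).
  have bjm : (bump i.+1 j <= m.+1)%N by rewrite /bump; lia.
  have [CL CH] := CG _ (lift i' b) bjm.
  split=> [/LL' /CL x0 v|/HH' /CH].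
    by rewrite memF // => /x0; rewrite insert0_lift.
  by rewrite memF // insert0_delta.
apply: Fl_intro => j jm.
  have [ij|ji] := ltnP i j.
    have := dim_insert0_add i' (subsp F j).
    by rewrite -hi ?ij // Fl_dim // => -[].
  by rewrite -(dim_insert0 i') -lo // Fl_dim //; lia.
apply/subvP => x; rewrite !memF //; last by lia.
by apply/subvP/Fl_mono; rewrite // /bump; lia.
Qed.

End Pop.

(** * Matrices of the flags in the image of P_i *)

Section PopMatrix.
Variables (m : nat) (i : 'I_m).
Local Notation i' := (widen_ord (leqnSn m) i).

(** The column of h from which column c of the larger matrix is made; columns i
    and i + 1 both come from column i. *)
Definition pop_idx (c : 'I_m.+1) : 'I_m := insubd i (unbump i c).

Lemma val_pop_idx c : pop_idx c = unbump i c :> nat.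
Proof.
rewrite /pop_idx insubdK // /in_mem /= /unbump.
by have := ltn_ord i; have := ltn_ord c; lia.
Qed.

Lemma lift_pop_idx (c : 'I_m.+1) : c != i :> nat -> lift i' (pop_idx c) = c.
Proof.
move=> ci; apply: val_inj; rewrite /= val_pop_idx.
by rewrite unbumpKcond /= (negbTE ci).
Qed.

(** If f is column i of h, then columns i and i + 1 of this matrix are x f + y
    e_i and z f + t e_i (after insertion of a zero), so that (x : y) is the
    coordinate on the projective line of flags over that of h. *)
Definition pop_mx (R : pzRingType) (h : 'M[R]_m) (x y z t : R) : 'M[R]_m.+1 :=
  \matrix_(a, c)
    if unlift i' a is Some a' then
      (if c == i :> nat then x else if c == i.+1 :> nat then z else 1)
        * h a' (pop_idx c)
    else if c == i :> nat then y else if c == i.+1 :> nat then t else 0.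

Lemma map_pop_mx (R S : pzRingType) (f : {rmorphism R -> S}) (h : 'M[R]_m)
    x y z t :
  map_mx f (pop_mx h x y z t) = pop_mx (map_mx f h) (f x) (f y) (f z) (f t).
Proof.
apply/matrixP => a c; rewrite !mxE; case: (unlift i' a) => [a'|].
  by rewrite rmorphM !mxE (fun_if f) (fun_if f) rmorph1.
by rewrite (fun_if f) (fun_if f) rmorph0.
Qed.

Section Field.
Variable K : closedFieldType.
Local Notation I := (insert0_mx K i').
Local Notation e_i := (delta_mx i' 0 : 'cV[K]_m.+1).
Implicit Types (h : 'M[K]_m) (x y z t : K).

Lemma col_pop_mx h x y z t (c : 'I_m.+1) : col c (pop_mx h x y z t) =
  (if c == i :> nat then x else if c == i.+1 :> nat then z else 1)
     *: (I *m col (pop_idx c) h) +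
  (if c == i :> nat then y else if c == i.+1 :> nat then t else 0) *: e_i.
Proof.
apply/colP => a; rewrite !mxE; case: (unliftP i' a) => [a'|] ->.
  have := insert0_lift i' (col (pop_idx c) h) a' 0; rewrite !mxE => ->.
  by rewrite [lift _ _ == _]eq_sym (negbTE (neq_lift _ _)) mulr0 addr0.
have := insert0_at i' (col (pop_idx c) h) 0; rewrite mxE => ->.
by rewrite mulr0 add0r !eqxx mulr1.
Qed.

Lemma line_pair (V : vectType K) (u e : V) x y z t : x * t - y * z != 0 ->
  (<[x *: u + y *: e]> + <[z *: u + t *: e]> = <[u]> + <[e]>)%VS.
Proof.
move=> d0; apply/eqP; rewrite eqEsubv !subv_add -!memvE.
have comb a b : a *: u + b *: e \in (<[u]> + <[e]>)%VS.
  by apply: memv_add; apply/memvZ/memv_line.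
rewrite !comb /=; set W := (_ + _)%VS.
have comb' a b : a *: (x *: u + y *: e) + b *: (z *: u + t *: e) \in W.
  by apply: memv_add; apply/memvZ/memv_line.
have uE : (x * t - y * z) *: u =
    t *: (x *: u + y *: e) + (- y) *: (z *: u + t *: e).
  rewrite !scalerDr !scalerA addrACA -!scalerDl mulNr mulNr (mulrC t x).
  by rewrite (mulrC t y) subrr scale0r addr0.
have eE : (x * t - y * z) *: e =
    (- z) *: (x *: u + y *: e) + x *: (z *: u + t *: e).
  rewrite !scalerDr !scalerA addrACA -!scalerDl mulNr mulNr (mulrC z x).
  by rewrite addNr scale0r add0r (mulrC z y) addrC.
have inv v : (x * t - y * z) *: v \in W -> v \in W.
  by move/(memvZ (x * t - y * z)^-1); rewrite scalerA mulVf // scale1r.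
by apply/andP; split; apply: inv; rewrite ?uE ?eE.
Qed.

Lemma colspan_pop_lo h x y z t j : (j <= i)%N ->
  colspan (pop_mx h x y z t) j = insert0 i' (colspan h j).
Proof.
elim: j => [|j IH] ji; first by rewrite !colspan0 /insert0 limg0.
have jm : (j < m)%N by exact: leq_trans ji (ltnW (ltn_ord i)).
have := colspanS (pop_mx h x y z t) (Ordinal (leqW jm)) => /= ->.
have := colspanS h (Ordinal jm) => /= ->.
rewrite IH ?(ltnW ji) // /insert0 limgD limg_line mulvE; congr (_ + <[_]>)%VS.
have [ji0 ji1] : (j == i) = false /\ (j == i.+1) = false by split; lia.
rewrite col_pop_mx /= ji0 ji1 scale1r scale0r addr0.
congr (_ *m col _ h); apply: val_inj; rewrite /= val_pop_idx /= /unbump.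
by rewrite ltnNge (ltnW ji) subn0.
Qed.

Lemma colspan_pop_mid h x y z t : colspan (pop_mx h x y z t) i.+1 =
  (insert0 i' (colspan h i) + <[x *: (I *m col i h) + y *: e_i]>)%VS.
Proof.
rewrite -(colspan_pop_lo h x y z t (leqnn i)).
have := colspanS (pop_mx h x y z t) i' => /= ->.
rewrite col_pop_mx /= eqxx; congr (_ + <[ _ *: (_ *m col _ h) + _]>)%VS.
by apply: val_inj; rewrite /= val_pop_idx /= /unbump ltnn subn0.
Qed.

Lemma colspan_pop_hi h x y z t j : x * t - y * z != 0 -> (i < j <= m)%N ->
  colspan (pop_mx h x y z t) j.+1 = (insert0 i' (colspan h j) + <[e_i]>)%VS.
Proof.
move=> d0; elim: j => [|j IH] // /andP[ij jm].
have := colspanS (pop_mx h x y z t) (Ordinal (jm : (j.+1 < m.+1)%N)) => /= ->.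
have := colspanS h (Ordinal jm) => /= ->.
rewrite /insert0 limgD limg_line mulvE col_pop_mx /=.
rewrite (gtn_eqF ij) (_ : pop_idx _ = Ordinal jm); last first.
  by apply: val_inj; rewrite /= val_pop_idx /= /unbump ij subn1.
move: ij; rewrite ltnS eqSS leq_eqVlt; case: ltngtP => //= [ij _|ij _].
  rewrite IH ?ij ?(ltnW jm) // scale1r scale0r addr0.
  by rewrite -!addvA (addvC <[e_i]>%VS).
have -> : Ordinal jm = i by apply: val_inj.
rewrite -ij colspan_pop_mid -addvA line_pair // addvA; congr (_ + _ + _)%VS.
Qed.

Lemma pop_rel_flag h x y z t : x * t - y * z != 0 ->
  pop_rel i (flag_of_mx h) (flag_of_mx (pop_mx h x y z t)).
Proof.
have im := ltn_ord i; move=> d0; split=> j ji.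
  by rewrite !subsp_flag ?colspan_pop_lo //; lia.
by rewrite !subsp_flag ?colspan_pop_hi //; lia.
Qed.

Lemma pop_mx_unit h x y z t :
  x * t - y * z != 0 -> h \in unitmx -> pop_mx h x y z t \in unitmx.
Proof.
move=> d0 hu; apply: unitmx_colspan.
rewrite (colspan_pop_hi _ d0) ?ltn_ord ?leqnn //.
by rewrite dim_insert0_add dim_colspan.
Qed.

Lemma pop_rel_inj F (G G' : subspaces K m.+1) :
  pop_rel i F G -> pop_rel i F G' -> subsp G i.+1 = subsp G' i.+1 -> G = G'.
Proof.
move=> [lo hi] [lo' hi'] E; apply: subsp_ext => j jm.
have [ji|ij|-> //] := ltngtP j i.+1; first by rewrite lo ?lo'.
by case: j jm ij => // j jm ij; rewrite hi ?hi' // -ltnS ij.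
Qed.

(** Another basis h' of the same flag has its i-th vector proportional to that
    of h modulo the preceding ones, so the point (x : y) is only rescaled. The
    vectors in position i + 1 do not affect the flag and may be replaced. *)
Lemma pop_mx_change h h' x y z t : Fl K m (flag_of_mx h) ->
    flag_of_mx h = flag_of_mx h' -> x * t - y * z != 0 -> x != 0 ->
  exists2 x', x' != 0 & forall z' t', x' * t' - y * z' != 0 ->
    flag_of_mx (pop_mx h x y z t) = flag_of_mx (pop_mx h' x' y z' t').
Proof.
move=> Fh hh' d0 x0; have im := ltn_ord i.
have spE j : (j <= m)%N -> colspan h j = colspan h' j.
  by move=> jm; rewrite -!subsp_flag // hh'.
have : col i h' \in colspan h i.+1 by rewrite spE // mem_colspan.
rewrite colspanS => /memv_addP[u uh [_ /vlineP[c ->] E]].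
have c0 : c != 0.
  apply: contraTneq (isT : true) => c0.
  have : (colspan h i.+1 <= colspan h i)%VS.
    rewrite (spE i.+1) // colspanS subv_add -spE ?(ltnW im) // subvv -memvE E.
    by rewrite c0 scale0r addr0.
  move=> /dimvS; rewrite -!subsp_flag ?(ltnW im) //.
  by rewrite !Fl_dim ?(ltnW im) // ltnn.
exists (x / c); first by rewrite mulf_neq0 ?invr_eq0.
move=> z' t' d0'; apply: (@pop_rel_inj (flag_of_mx h)).
- exact: pop_rel_flag.
- by rewrite hh'; apply: pop_rel_flag.
rewrite !subsp_flag ?ltnS ?(ltnW im) // !colspan_pop_mid.
rewrite -(spE i) ?(ltnW im) // E.
set v := I *m col i h; have uI : I *m u \in insert0 i' (colspan h i).
  by rewrite -mulvE memv_img.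
have -> : (x / c) *: (I *m (u + c *: col i h)) + y *: e_i =
    (x / c) *: (I *m u) + (x *: v + y *: e_i).
  by rewrite mulmxDr -scalemxAr scalerDr scalerA divfK // addrA.
apply/eqP; rewrite eqEsubv !subv_add !addvSl -!memvE /=.
set W := insert0 _ _; apply/andP; split.
  rewrite -[X in X \in _](addKr ((x / c) *: (I *m u))) -scaleNr.
  by apply: memv_add; rewrite ?memv_line ?memvZ.
by apply: memv_add; rewrite ?memv_line ?memvZ.
Qed.

End Field.
End PopMatrix.

(** * Deforming a flag into the open stratum *)

Section Deformation.
Variable K : closedFieldType.

(** The space in position j is related to the label of coordinate j - 1, the
    one at which it ends. *)
Definition perm_lo (w : nat -> nat) (j b : nat) : Prop :=
  [&& 0 < j, j.-1 < b & w b < w j.-1]%N.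

Definition perm_hi (w : nat -> nat) (j b : nat) : Prop :=
  ((b < j.-1) && (w b < w j.-1))%N.

(** The smallest label is smaller than those of its neighbours, so its
    conditions are the ones of P_i; and it is never the larger label in a
    condition, so it imposes nothing on the other coordinates. *)
Lemma Pop_perm m (i : 'I_m) (w : nat -> nat) :
    (forall a, (a <= m)%N -> a != i -> (w i < w a)%N) ->
  Pop i (constrained (K := K) (n := m) (perm_lo (w \o bump i))
                     (perm_hi (w \o bump i))) =
  constrained (n := m.+1) (perm_lo w) (perm_hi w).
Proof.
move=> wi; have im := ltn_ord i.
have wi' a : (a <= m)%N -> a != i -> (w a < w i)%N = false.
  by move=> am ai; have := wi a am ai; lia.
apply: Pop_constrained; rewrite /perm_lo /perm_hi /=.
- move=> j b jm bm; have [-> | j0] := posnP j.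
    by split; split=> //; case/andP; rewrite /bump; lia.
  have -> : (bump i.+1 j).-1 = bump i j.-1 by rewrite /bump; lia.
  have -> : (0 < bump i.+1 j)%N by rewrite /bump; lia.
  by rewrite !ltnNge !leq_bump2.
- by move=> b bm bi; rewrite /= (wi' b bm bi) !andbF.
- by move=> j /and3P[]; lia.
- by move=> i0; rewrite i0 (wi i.-1) ?andbT /=; lia.
- by move=> j /andP[]; lia.
- by rewrite (wi i.+1) ?andbT /=; lia.
Qed.

(** Permuting the coordinates of such a flag by w gives a flag in the opposite
    cell of w: the j-th basis vector has e_j as its term of smallest label. *)
Definition lower_basis n (w : nat -> nat) (G : subspaces K n.+1) : Prop :=
  exists2 B : 'M[K]_n.+1, G = flag_of_mx B &
    forall j, B j j != 0 /\ forall a : 'I_n.+1, (w a < w j)%N -> B a j = 0.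

(** The same for the Schubert cell of w c: the j-th basis vector has e_(j-1) as
    its term of largest label, and the first one has the last coordinate
    vector. *)
Definition upper_basis n (w : nat -> nat) (G : subspaces K n.+1) : Prop :=
  exists2 B : 'M[K]_n.+1, G = flag_of_mx B &
    forall j, B (ord_pred j) j != 0 /\
      forall a : 'I_n.+1, (w (ord_pred j) < w a)%N -> B a j = 0.

Lemma val_ord_pred n (j : 'I_n.+1) :
  ord_pred j = (if j == 0 :> nat then n else j.-1) :> nat.
Proof.
rewrite /= -[LHS]/((j + n.+1).-1 %% n.+1)%N addnS /=; case: eqP => [->|j0].
  by rewrite modn_small.
have -> : (j + n = j.-1 + n.+1)%N by lia.
by rewrite modnDr modn_small //; have := ltn_ord j; lia.
Qed.

(** With f the i-th vector of the given basis, the new basis has x f + y e_i in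
    position i, where e_i has the smallest label, and f, which starts with the
    old e_i, now renumbered i + 1, in position i + 1. *)
Lemma lower_basis_pop m (i : 'I_m.+1) (w : nat -> nat)
    (B : 'M[K]_m.+1) (x y : K) :
    (forall a : nat, (a <= m.+1)%N -> a != i -> (w i < w a)%N) ->
    (forall j, B j j != 0 /\
       forall a : 'I_m.+1, (w (bump i a) < w (bump i j))%N -> B a j = 0) ->
    y != 0 ->
  lower_basis w (flag_of_mx (pop_mx i B x y 1 0)).
Proof.
move=> wi HB y0; exists (pop_mx i B x y 1 0) => // j.
set i' := widen_ord (leqnSn m.+1) i.
have iE : i' = i :> nat by [].
have wi' (a : 'I_m.+2) : (w a < w i)%N = false.
  have [->|ai] := eqVneq (a : nat) i; first by rewrite ltnn.
  by have := wi a (ltn_ord a) ai; lia.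
have [jE|ji] := eqVneq (j : nat) i.
  have -> : j = i' by apply: val_inj.
  by rewrite mxE unlift_none eqxx; split=> // a; rewrite wi'.
have jL : j = lift i' (pop_idx i j) by rewrite lift_pop_idx.
have [B0 Ba] := HB (pop_idx i j).
split.
  rewrite [X in pop_mx _ _ _ _ _ _ X _]jL mxE liftK (negbTE ji) if_same.
  by rewrite mul1r.
move=> a; case: (unliftP i' a) => [a'|] -> wa.
  rewrite mxE liftK (negbTE ji) if_same mul1r Ba //.
  by move: wa; rewrite {1}jL.
by rewrite mxE unlift_none (negbTE ji) if_same.
Qed.

Lemma ord_pred_pop m (i : 'I_m.+1) (j : 'I_m.+2) : j != i.+1 :> nat ->
  ord_pred j = lift (widen_ord (leqnSn m.+1) i) (ord_pred (pop_idx i j)).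
Proof.
move=> ji; apply: val_inj.
rewrite -[RHS]/(bump i (ord_pred (pop_idx i j))) -[LHS]/(nat_of_ord _).
rewrite !val_ord_pred val_pop_idx /bump /unbump.
have im := ltn_ord i; have jm := ltn_ord j.
by case: (ltngtP i j) => ij; case: eqP => ?; case: eqP => ?; lia.
Qed.

(** Here the vectors in positions i and i + 1 are x f + y e_i, which has the
    same term of largest label as f, and e_i. *)
Lemma upper_basis_pop m (i : 'I_m.+1) (w : nat -> nat)
    (B : 'M[K]_m.+1) (x y : K) :
    (forall a : nat, (a <= m.+1)%N -> a != i -> (w i < w a)%N) ->
    (forall j, B (ord_pred j) j != 0 /\
       forall a : 'I_m.+1, (w (bump i (ord_pred j)) < w (bump i a))%N -> B a j = 0) ->
    x != 0 ->
  upper_basis w (flag_of_mx (pop_mx i B x y 0 1)).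
Proof.
move=> wi HB x0; exists (pop_mx i B x y 0 1) => // j.
set i' := widen_ord (leqnSn m.+1) i.
have wi' (a : 'I_m.+2) : (w a < w i)%N = false.
  have [->|ai] := eqVneq (a : nat) i; first by rewrite ltnn.
  by have := wi a (ltn_ord a) ai; lia.
have [jE|ji] := eqVneq (j : nat) i.+1.
  have -> : ord_pred j = i'.
    by apply: ord_inj; rewrite val_ord_pred jE.
  have ji : (j == i :> nat) = false by rewrite jE; lia.
  rewrite mxE unlift_none ji jE eqxx oner_eq0; split=> // a.
  case: (unliftP i' a) => [a'|] -> //=; last by rewrite ltnn.
  by rewrite mxE liftK ji jE eqxx mul0r.
have jP := ord_pred_pop ji; rewrite -/i' in jP.
have [B0 Ba] := HB (pop_idx i j).
rewrite jP; split.
  rewrite mxE liftK (negbTE ji); case: ifP => _; last by rewrite mul1r.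
  by rewrite mulf_neq0.
move=> a; case: (unliftP i' a) => [a'|] -> wa.
  by rewrite mxE liftK Ba ?mulr0.
by move: wa; rewrite -[nat_of_ord i']/(nat_of_ord i) wi'.
Qed.

(** The smallest label is not the last one, so it can be removed by undoing
    some P_i, and the remaining labels satisfy the same hypotheses. *)
Lemma min_label m (w : nat -> nat) :
    (forall a b, (a <= m.+1)%N -> (b <= m.+1)%N -> w a = w b -> a = b) ->
    (forall a, (a < m.+1)%N -> (w a < w m.+1)%N) ->
  exists i : 'I_m.+1,
    [/\ forall a : nat, (a <= m.+1)%N -> a != i -> (w i < w a)%N,
        forall a b, (a <= m)%N -> (b <= m)%N ->
          (w \o bump i) a = (w \o bump i) b -> a = b &
        forall a, (a < m)%N -> ((w \o bump i) a < (w \o bump i) m)%N].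
Proof.
move=> w_inj w_max.
have [i0 _ i0_min] :=
  @arg_minnP _ (ord0 : 'I_m.+2) xpredT (fun a : 'I_m.+2 => w a) isT.
have im : (i0 < m.+1)%N.
  rewrite ltn_neqAle -ltnS ltn_ord andbT; apply/negP => /eqP E.
  have := i0_min ord0 isT; rewrite /= E leqNgt.
  by rewrite w_max.
exists (Ordinal im); split=> [a am ai|a b am bm|a am] /=.
- have := i0_min (Ordinal (am : (a < m.+2)%N)) isT => /=.
  rewrite leq_eqVlt => /orP[/eqP/w_inj E|//].
  by case/eqP: ai; rewrite -E // -ltnS.
- by move=> /w_inj/(can_inj (bumpK _)); apply; rewrite /bump; lia.
- have -> : bump i0 m = m.+1 by rewrite /bump; lia.
  by apply: w_max; rewrite /bump; lia.
Qed.

(** By induction, removing the smallest label. The smaller flag moves along a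
    curve, and the coordinate (x : y) of the given one on the projective line
    over it moves so that both entries become nonzero. *)
Lemma deformation n (w : nat -> nat) (G : subspaces K n.+1) :
    (forall a b, (a <= n)%N -> (b <= n)%N -> w a = w b -> a = b) ->
    (forall a, (a < n)%N -> (w a < w n)%N) ->
    constrained (perm_lo w) (perm_hi w) G ->
  exists (h : 'M[{poly K}]_n.+1) (q : {poly K}),
    [/\ q != 0, flag_of_mx (map_mx (horner_eval 0) h) = G &
        forall t, q.[t] != 0 ->
          let F := flag_of_mx (map_mx (horner_eval t) h) in
          lower_basis w F /\ upper_basis w F].
Proof.
elim: n w G => [|m IH] w G w_inj w_max GC.
  exists 1%:M, 1; split; first exact: oner_neq0.
    case: GC => FG _; apply: subsp_ext => j j1.
    rewrite map_mx1 subsp_flag //.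
    case: j j1 => [|[|]] // _; first by rewrite colspan0 Fl0.
    by rewrite (Fl_full FG) -(subsp_flag 1%:M) // Fl_full //;
       apply/Fl_flag_of_mx/unitmx1.
  move=> t _; split; exists 1%:M; rewrite ?map_mx1 // => j; rewrite (ord1 j).
    by rewrite mxE oner_neq0; split=> // a; rewrite (ord1 a) ltnn.
  rewrite !(ord1 (ord_pred _)) mxE oner_neq0; split=> // a.
  by rewrite (ord1 a) ltnn.
have [i [wi wi_inj wi_max]] := min_label w_inj w_max.
have im := ltn_ord i.
move: GC; rewrite -(Pop_perm wi) PopP => -[FG [F FC FG_]].
have [hF [qF [qF0 hFE gen]]] := IH _ _ wi_inj wi_max FC.
set h0 := map_mx _ _ in hFE.
have FF : Fl K m.+1 F by case: FC.
have det0 : \det hF != 0.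
  have := Fl_unitmx (eq_ind_r _ FF hFE); apply: contraTneq => d0.
  by rewrite unitmxE /h0 (det_map_mx (horner_eval 0)) d0 rmorph0 unitr0.
have F1 : subsp F i.+1 = colspan h0 i.+1 by rewrite -hFE subsp_flag.
pose f0 := insert0_mx K (widen_ord (leqnSn m.+1) i) *m col i h0.
pose e_i : 'cV[K]_m.+2 := delta_mx (widen_ord (leqnSn m.+1) i) 0.
have [x [y [xy0 GE]]] : exists x y, (x != 0) || (y != 0) /\
    subsp G i.+1 = (subsp G i + <[x *: f0 + y *: e_i]>)%VS.
  have : ~~ (subsp G i.+1 <= subsp G i)%VS.
    by apply/negP => /dimvS; rewrite !Fl_dim ?ltnn //; lia.
  case/subvPn => g gG gi; have : g \in subsp G i.+2.
    by move: gG; apply/subvP/Fl_mono => //=; lia.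
  rewrite FG_.2 /=; last by lia.
  rewrite F1 colspanS /insert0 limgD limg_line mulvE -/f0.
  case/memv_addP => _ /memv_addP[u uF [_ /vlineP[x ->] ->]] [_ /vlineP[y ->]].
  rewrite -addrA => gE; exists x, y.
  have {}uF : u \in subsp G i.
    by rewrite FG_.1 // -hFE subsp_flag // ltnW.
  split.
    apply: contraR gi; rewrite negb_or !negbK => /andP[/eqP x0 /eqP y0].
    by rewrite gE x0 y0 !scale0r !addr0.
  apply: addv_line_eq.
  - by apply: Fl_mono => //=; lia.
  - by rewrite !Fl_dim //=; lia.
  - rewrite -(addKr u (_ + _)) -gE addrC memvB //.
    by move: uF; apply/subvP/Fl_mono => //=; lia.
  - by apply: contra gi => vG; rewrite gE memvD.
(* The one of x and y that is known to be nonzero stays constant, which keeps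
   the determinant x t - y z constant, and the other one moves. *)
pose xp : {poly K} := if x != 0 then x%:P else 'X.
pose yp : {poly K} := if x != 0 then y%:P + 'X else y%:P.
pose z : K := (x == 0)%:R; pose t : K := (x != 0)%:R.
have xp0 : xp.[0] = x.
  by rewrite /xp; case: eqP => /= [->|]; rewrite ?hornerX ?hornerC.
have yp0 : yp.[0] = y.
  by rewrite /yp; case: eqP => /= _; rewrite ?hornerD ?hornerX ?hornerC ?addr0.
have xpn0 : xp != 0.
  by rewrite /xp; case: ifP => x0; rewrite ?polyC_eq0 ?polyX_eq0.
have ypn0 : yp != 0.
  rewrite /yp; case: ifP => x0; last by move: xy0; rewrite x0 polyC_eq0.
  by rewrite -size_poly_eq0 addrC size_addl size_polyX ?size_polyC; case: eqP.
have d0 s : xp.[s] * t - yp.[s] * z != 0.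
  rewrite /xp /yp /t /z; have [x0|x0] /= := eqVneq x 0.
    rewrite mulr0 mulr1 sub0r oppr_eq0 hornerC.
    by move: xy0; rewrite x0 eqxx.
  by rewrite mulr1 mulr0 subr0 hornerC.
exists (pop_mx i hF xp yp z%:P t%:P), (qF * \det hF * xp * yp).
split; first by rewrite !mulf_neq0.
  apply: (@pop_rel_inj _ i _ F) => //.
    by rewrite map_pop_mx /= /horner_eval !hornerC -hFE; apply: pop_rel_flag.
  rewrite subsp_flag ?map_pop_mx; last by rewrite /=; lia.
  rewrite /= /horner_eval !hornerC xp0 yp0 colspan_pop_mid GE FG_.1 //.
  by rewrite -hFE subsp_flag // ltnW.
move=> s; rewrite !hornerM !mulf_eq0 !negb_or.
move=> /andP[/andP[/andP[qs ds] xs] ys].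
have [[B1 E1 lead1] [B2 E2 lead2]] := gen s qs.
rewrite map_pop_mx /= /horner_eval !hornerC.
set hs := map_mx _ hF in E1 E2 *.
have Fs : Fl K m.+1 (flag_of_mx hs).
  apply: Fl_flag_of_mx.
  by rewrite unitmxE /hs (det_map_mx (horner_eval s)) unitfE.
split.
  have [x' x'0 E] := pop_mx_change i Fs E1 (d0 s) xs.
  rewrite (E 1 0); last by rewrite mulr0 mulr1 sub0r oppr_eq0.
  exact: lower_basis_pop.
have [x' x'0 E] := pop_mx_change i Fs E2 (d0 s) xs.
rewrite (E 0 1); last by rewrite mulr0 mulr1 subr0.
exact: upper_basis_pop.
Qed.

End Deformation.

(** * Translated Richardson varieties *)

Section TranslatedRichardson.
Variable K : closedFieldType.

Definition perm_nat n (w : 'S_n.+1) : nat -> nat := fun b => w (inord b).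

Lemma perm_nat_val n (w : 'S_n.+1) (a : 'I_n.+1) : perm_nat w a = w a.
Proof. by rewrite /perm_nat inord_val. Qed.

Lemma back_cycle_mulE n (w : 'S_n.+1) a :
  (back_cycle n.+1 * w)%g a = w (ord_pred a).
Proof. by rewrite permM permE. Qed.

Lemma horner_eval_polyC m n (A : 'M[K]_(m, n)) t :
  map_mx (horner_eval t) (map_mx (@polyC K) A) = A.
Proof. by apply/matrixP => a b; rewrite !mxE /horner_eval hornerC. Qed.

Lemma perm_nat_labels n (w : 'S_n.+1) : fix_last n w ->
  (forall a b, (a <= n)%N -> (b <= n)%N ->
     perm_nat w a = perm_nat w b -> a = b) /\
  (forall a, (a < n)%N -> (perm_nat w a < perm_nat w n)%N).
Proof.
move=> w_last; split=> [a b an bn /ord_inj/perm_inj/(congr1 val)|a an].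
  by rewrite /= !inordK.
have wn : perm_nat w n = n.
  by have := perm_nat_val w ord_max; rewrite /= w_last.
rewrite wn ltn_neqAle -ltnS ltn_ord andbT -[X in _ != X]wn.
apply/eqP => /ord_inj/perm_inj/(congr1 val).
by rewrite /= !inordK ?ltnS ?(ltnW an) // => an'; rewrite an' ltnn in an.
Qed.

Lemma constrained_sub_translated n (w : 'S_n.+1) : fix_last n w ->
  constrained (n := n.+1) (perm_lo (perm_nat w)) (perm_hi (perm_nat w)) `<=`
  translated_richardson K w.
Proof.
move=> w_last G GC.
have [w_inj w_max] := perm_nat_labels w_last.
have [h [q [q0 hG gen]]] := deformation w_inj w_max GC.
pose P := perm_matrix K w; pose hw := map_mx (@polyC K) P *m h.
have hwE t : map_mx (horner_eval t) hw = P *m map_mx (horner_eval t) h.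
  by rewrite map_mxM horner_eval_polyC.
have FG : Fl K n.+1 G by case: GC.
have hw0 : map_mx (horner_eval 0) hw \in unitmx.
  by rewrite hwE unitmx_mul perm_matrix_unit Fl_unitmx // hG.
exists (mx_act P G); last by rewrite mx_act_comp perm_matrixV mx_act1.
rewrite -hG mx_act_flag -hwE; split; apply: (closure_curve q0 hw0) => t qt.
  have [_ [B hB lead]] := gen t qt.
  rewrite hwE -mx_act_flag hB mx_act_flag; apply: cell_lead => a j.
    rewrite back_cycle_mulE => lt; apply: (proj2 (lead j)).
    by rewrite !perm_nat_val.
  by rewrite back_cycle_mulE => /perm_inj ->; have [] := lead j.
have [[B hB lead] _] := gen t qt.
rewrite hwE -mx_act_flag hB mx_act_flag; apply: opp_cell_lead => a j.
  by move=> lt; apply: (proj2 (lead j)); rewrite !perm_nat_val.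
by move=> /perm_inj ->; have [] := lead j.
Qed.

(** The map a |-> a + 1 sends positions for w to positions for w c. It stays
    below j because the last position below j is excluded by hypothesis. *)
Lemma card_back_cycle n (w : 'S_n.+1) (S : pred 'I_n.+1) j :
    (0 < j <= n.+1)%N -> ~~ S (w (inord j.-1)) ->
  (#|[pred a : 'I_n.+1 | (a < j)%N && S (w a)]| <=
   #|[pred a : 'I_n.+1 | (a < j)%N && S ((back_cycle n.+1 * w)%g a)]|)%N.
Proof.
move=> /andP[j0 jn] Sj; pose f (a : 'I_n.+1) : 'I_n.+1 := inord a.+1.
have lt_j (a : 'I_n.+1) : (a < j)%N && S (w a) -> (a.+1 < j)%N.
  move=> /andP[aj Sa]; rewrite ltn_neqAle aj andbT; apply: contraNneq Sj => ja.
  by rewrite -ja /= inord_val.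
have fE (a : 'I_n.+1) : (a < j)%N && S (w a) -> f a = a.+1 :> nat.
  by move=> /lt_j aj; rewrite inordK // (leq_trans aj).
rewrite -(card_in_image (f := f)); last first.
  move=> a b /fE fa /fE fb /(congr1 val) /=.
  by rewrite fa fb => -[] /ord_inj.
apply: subset_leq_card; apply/fintype.subsetP => _ /fintype.imageP[a aP ->].
have aj := lt_j a aP.
rewrite inE fE // aj back_cycle_mulE.
have -> : ord_pred (f a) = a by apply: ord_inj; rewrite val_ord_pred fE.
by case/andP: aP.
Qed.

(** Each condition is the extreme case of two Schubert inequalities, one from
    each cell, for the coordinates up to w b and for those from w b on, where w
    b is counted on both sides or on neither. *)
Lemma translated_sub_constrained n (w : 'S_n.+1) :
  translated_richardson K w `<=`
  constrained (n := n.+1) (perm_lo (perm_nat w)) (perm_hi (perm_nat w)).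
Proof.
move=> _ [F [clU clL] <-].
have up (S : pred 'I_n.+1) j : (forall c d : 'I_n.+1, (c <= d)%N -> S d -> S c) ->
    (j <= n.+1)%N -> Fl K n.+1 F /\
    (#|[pred a : 'I_n.+1 | (a < j)%N && S ((back_cycle n.+1 * w)%g a)]| <=
       \dim (subsp F j :&: coordsp K S))%N.
  move=> Sdown jn; apply: cell_closure_dim jn clU => b [bu /is_trig_mxP bt].
  split=> // c d Sc Sd; have := bt c d; rewrite mxE; apply.
  by rewrite ltnNge; apply: contra Sd => dc; apply: Sdown Sc.
have low (S : pred 'I_n.+1) j : (forall c d : 'I_n.+1, (c <= d)%N -> S c -> S d) ->
    (j <= n.+1)%N -> Fl K n.+1 F /\
    (#|[pred a : 'I_n.+1 | (a < j)%N && S (w a)]| <=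
       \dim (subsp F j :&: coordsp K S))%N.
  move=> Sup jn; apply: cell_closure_dim jn clL => b [bu /is_trig_mxP bt].
  split=> // c d Sc Sd; apply: bt.
  by rewrite ltnNge; apply: contra Sd => dc; apply: Sup Sc.
have FF : Fl K n.+1 F by have [] := up xpredT 0.
split=> [|j b jn]; first exact/Fl_act/FF/perm_matrix_unit.
rewrite /perm_lo /perm_hi !perm_nat_val /perm_nat subsp_act.
have cardj := card_ord_lt jn; have dimF := Fl_dim FF jn.
split=> [/and3P[j0 jb wbj] v|/andP[bj wbj]].
  move=> /memv_imgP[x xF ->]; rewrite mulvE perm_matrix_mul invgK.
  have [_ dU] := up (fun c => (c < w b)%N) j (fun c d cd => leq_ltn_trans cd) jn.
  have [_ dL] := low (fun c => (w b < c)%N) j (fun c d cd wc => leq_trans wc cd) jn.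
  have := @card_back_cycle n w (fun c => (c < w b)%N) j.
  rewrite j0 jn -leqNgt (ltnW wbj) => /(_ isT isT) /leq_trans/(_ dU) {}dU.
  set A := (X in (#|X| <= _)%N) in dU; set B := (X in (#|X| <= _)%N) in dL.
  have cover : (j <= #|A| + #|B|)%N.
    rewrite -cardUI -[leqLHS]cardj; apply: leq_trans (leq_addr _ _).
    apply: subset_leq_card; apply/fintype.subsetP => a; rewrite !inE => aj.
    rewrite aj /= -neq_ltn; apply: contraTneq aj => /ord_inj/perm_inj ->.
    by rewrite -leqNgt; lia.
  set U := (_ :&: _)%VS in dU; set V := (_ :&: _)%VS in dL.
  have UV0 : (U :&: V = 0)%VS.
    apply/eqP; rewrite -subv0; apply/subvP => y.
    rewrite !memv_cap => /andP[/andP[_ /coordspP yU] /andP[_ /coordspP yV]].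
    rewrite memv0; apply/eqP/colP => c; rewrite mxE.
    have [cb|bc] := ltnP c (w b); first by apply: yV; rewrite -leqNgt ltnW.
    by apply: yU; rewrite -leqNgt.
  have UVF : (U + V)%VS = subsp F j.
    apply/eqP; rewrite eqEdim subv_add !capvSl /= dimv_disjoint_sum // dimF.
    by rewrite (leq_trans cover) // leq_add.
  move: xF; rewrite -UVF => /memv_addP[y yU [z zV ->]].
  move: yU zV; rewrite !memv_cap.
  move=> /andP[_ /coordspP yU] /andP[_ /coordspP zV].
  by rewrite mxE yU ?zV ?addr0 // ltnn.
have j0 : (0 < j)%N by lia.
apply/memv_imgP; exists (delta_mx (w b) 0); last first.
  apply/colP => a; rewrite mulvE perm_matrix_mul invgK !mxE.
  by rewrite (inj_eq perm_inj).
have [_ dU] := up (fun c => (c <= w b)%N) j (fun c d cd => leq_trans cd) jn.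
have [_ dL] := low (fun c => (w b <= c)%N) j (fun c d cd wc => leq_trans wc cd) jn.
have := @card_back_cycle n w (fun c => (c <= w b)%N) j.
rewrite j0 jn -ltnNge wbj => /(_ isT isT) /leq_trans/(_ dU) {}dU.
set A := (X in (#|X| <= _)%N) in dU; set B := (X in (#|X| <= _)%N) in dL.
have cover : (j < #|A| + #|B|)%N.
  rewrite -cardUI -[in ltnLHS]cardj -[ltnLHS]addn0 -addnS; apply: leq_add.
    apply: subset_leq_card; apply/fintype.subsetP => a; rewrite !inE => aj.
    by rewrite aj /= leq_total.
  by apply/card_gt0P; exists b; rewrite !inE !leqnn /= andbT; lia.
set U := (_ :&: _)%VS in dU; set V := (_ :&: _)%VS in dL.
have UVF : (\dim (U + V) <= j)%N.
  by rewrite -[leqRHS]dimF; apply: dimvS; rewrite subv_add !capvSl.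
(* U and V are the intersections with the spans of the e_c with c <= w b and
   w b <= c, so a nonzero vector in both is a multiple of e_(w b). *)
have UV0 : (U :&: V)%VS != 0%VS.
  rewrite -dimv_eq0; have := dimv_sum_cap U V.
  have : (j < \dim U + \dim V)%N by rewrite (leq_trans cover) // leq_add.
  lia.
have := memv_pick (U :&: V)%VS; move: UV0; rewrite -vpick0.
set y := vpick _ => y0; rewrite !memv_cap.
move=> /andP[/andP[yF /coordspP yU] /andP[_ /coordspP yV]].
have yE : y = y (w b) 0 *: delta_mx (w b) 0.
  apply/colP => c; rewrite !mxE andbT.
  have [->|cb] := eqVneq c (w b); first by rewrite mulr1.
  rewrite mulr0; case: (ltngtP c (w b)) => [lt|lt|/ord_inj E].
  - by apply: yV; rewrite -ltnNge.
  - by apply: yU; rewrite -ltnNge.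
  - by rewrite E eqxx in cb.
have c0 : y (w b) 0 != 0.
  by apply: contra y0 => /eqP c0; rewrite yE c0 scale0r.
have := memvZ (y (w b) 0)^-1 yF.
by rewrite {2}yE scalerA mulVf // scale1r.
Qed.

Lemma translated_richardsonE n (w : 'S_n.+1) : fix_last n w ->
  translated_richardson K w =
  constrained (n := n.+1) (perm_lo (perm_nat w)) (perm_hi (perm_nat w)).
Proof.
move=> w_last; apply/seteqP; split; first exact: translated_sub_constrained.
exact: constrained_sub_translated.
Qed.

End TranslatedRichardson.

(** * Leaves below the nodes of a tree *)

Section TreeCombinatorics.

(** The leaves below node b are those in positions node_lo T b, ..., node_hi T
    b - 1, where node b separates leaves b and b + 1. The values are meaningful
    for b + 1 < nleaves T only. *)
Fixpoint node_lo (T : tree) (b : nat) : nat :=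
  if T is Node l r then
    if (b.+1 < nleaves l)%N then node_lo l b
    else if b.+1 == nleaves l then 0%N
    else (nleaves l + node_lo r (b - nleaves l))%N
  else 0%N.

Fixpoint node_hi (T : tree) (b : nat) : nat :=
  if T is Node l r then
    if (b.+1 < nleaves l)%N then node_hi l b
    else if b.+1 == nleaves l then (nleaves l + nleaves r)%N
    else (nleaves l + node_hi r (b - nleaves l))%N
  else 0%N.

Lemma nleaves_gt0 T : (0 < nleaves T)%N.
Proof. by elim: T => //= l IHl r _; rewrite addn_gt0 IHl. Qed.

Lemma nleaves_split T i :
  (i < nleaves T)%N -> nleaves (split_leaf T i) = (nleaves T).+1.
Proof.
elim: T i => [|l IHl r IHr] i //= lt; case: ltnP => il /=.
  by rewrite IHl // addSn.
by rewrite IHr ?addnS //; lia.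
Qed.

Lemma node_lo_le T b : (node_lo T b <= b)%N.
Proof.
elim: T b => [|l IHl r IHr] b //=; case: ltnP => bl; first exact: IHl.
case: eqP => // bl'; have := IHr (b - nleaves l)%N; lia.
Qed.

Lemma node_hi_le T b : (b.+1 < nleaves T)%N -> (node_hi T b <= nleaves T)%N.
Proof.
elim: T b => [|l IHl r IHr] b //= lt; case: ltnP => bl.
  by have := IHl b bl; lia.
case: eqP => // bl'; have := IHr (b - nleaves l)%N; lia.
Qed.

Lemma node_lo_split T i b : (i < nleaves T)%N -> (b.+1 < nleaves T)%N ->
  node_lo (split_leaf T i) (bump i b) = bump i.+1 (node_lo T b).
Proof.
elim: T i b => [|l IHl r IHr] i b //= iT bT.
have ir : (nleaves l <= i)%N -> (i - nleaves l < nleaves r)%N by lia.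
have [il|li] := ltnP i (nleaves l); rewrite /= ?nleaves_split ?ir //.
  have [bl|bl] := ltnP b.+1 (nleaves l).
    by rewrite -IHl // ifT // /bump; lia.
  rewrite ifF; last by rewrite /bump; lia.
  have -> : bump i b = b.+1 by rewrite /bump; lia.
  rewrite eqSS; case: eqP => // bl'; rewrite subSS /bump; lia.
have [bl|bl] := ltnP b.+1 (nleaves l).
  have -> : bump i b = b by rewrite /bump; lia.
  by rewrite bl /bump; have := node_lo_le l b; lia.
rewrite ifF; last by rewrite /bump; lia.
case: (b.+1 =P nleaves l) => bl'.
  by rewrite ifT // /bump; lia.
rewrite ifF; last by rewrite /bump; lia.
have -> : (bump i b - nleaves l = bump (i - nleaves l) (b - nleaves l))%N.
  by rewrite /bump; lia.
by rewrite IHr /bump; lia.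
Qed.

Lemma node_hi_split T i b : (i < nleaves T)%N -> (b.+1 < nleaves T)%N ->
  node_hi (split_leaf T i) (bump i b) = bump i.+1 (node_hi T b).
Proof.
elim: T i b => [|l IHl r IHr] i b //= iT bT.
have ir : (nleaves l <= i)%N -> (i - nleaves l < nleaves r)%N by lia.
have [il|li] := ltnP i (nleaves l); rewrite /= ?nleaves_split ?ir //.
  have [bl|bl] := ltnP b.+1 (nleaves l).
    by rewrite -IHl // ifT // /bump; lia.
  rewrite ifF; last by rewrite /bump; lia.
  have -> : bump i b = b.+1 by rewrite /bump; lia.
  rewrite eqSS; case: eqP => bl'; rewrite ?subSS /bump; lia.
have [bl|bl] := ltnP b.+1 (nleaves l).
  have -> : bump i b = b by rewrite /bump; lia.
  by rewrite bl /bump; have := node_hi_le bl; lia.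
rewrite ifF; last by rewrite /bump; lia.
case: (b.+1 =P nleaves l) => bl'.
  by rewrite ifT /bump; lia.
rewrite ifF; last by rewrite /bump; lia.
have -> : (bump i b - nleaves l = bump (i - nleaves l) (b - nleaves l))%N.
  by rewrite /bump; lia.
by rewrite IHr /bump; lia.
Qed.

Lemma node_split T i : (i < nleaves T)%N ->
  node_lo (split_leaf T i) i = i /\ node_hi (split_leaf T i) i = i.+2.
Proof.
elim: T i => [|l IHl r IHr] i /= iT; first by case: i iT.
have ir : (nleaves l <= i)%N -> (i - nleaves l < nleaves r)%N by lia.
have [il|li] := ltnP i (nleaves l); rewrite /= ?nleaves_split ?ir //.
  by rewrite !ltnS il; exact: IHl.
have [-> ->] := IHr (i - nleaves l)%N ltac:(lia).
by rewrite !ifF; lia.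
Qed.

(** The nodes b with hi equal to the number of leaves form the right spine of
    the tree; the first of them is the root, which gives the number of leaves
    of the left subtree. *)
Lemma node_hi_inj T T' : nleaves T = nleaves T' ->
  (forall b, (b.+1 < nleaves T)%N -> node_hi T b = node_hi T' b) -> T = T'.
Proof.
elim: T T' => [|l IHl r IHr] [|l' r'] //= E hiE.
- by have := nleaves_gt0 l'; have := nleaves_gt0 r'; lia.
- by have := nleaves_gt0 l; have := nleaves_gt0 r; lia.
have [l0 r0] := (nleaves_gt0 l, nleaves_gt0 r).
have [l0' r0'] := (nleaves_gt0 l', nleaves_gt0 r').
have El : nleaves l = nleaves l'.
  have [lt|lt|//] := ltngtP (nleaves l) (nleaves l').
    have := hiE (nleaves l).-1 ltac:(lia); rewrite prednK // ltnn eqxx lt.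
    by have := @node_hi_le l' (nleaves l).-1; lia.
  have := hiE (nleaves l').-1 ltac:(lia); rewrite prednK // ltnn eqxx lt.
  by have := @node_hi_le l (nleaves l').-1; lia.
congr Node.
  apply: IHl => // b bl; have := hiE b ltac:(lia).
  by rewrite -El bl.
apply: IHr => [|b br]; first by lia.
have := hiE (nleaves l + b)%N ltac:(lia); rewrite -El addKn.
by rewrite !ifF; lia.
Qed.

Lemma split_leaf_surj T : (1 < nleaves T)%N ->
  exists T' i, (i < nleaves T')%N /\ T = split_leaf T' i.
Proof.
elim: T => [|l IHl r IHr] //= _.
have [l1|l1] := ltnP 1 (nleaves l).
  have [l' [i [il ->]]] := IHl l1; exists (Node l' r), i.
  by rewrite /= il; split=> //; lia.
have [r1|r1] := ltnP 1 (nleaves r).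
  have [r' [i [ir ->]]] := IHr r1; exists (Node l r'), (nleaves l + i)%N.
  by rewrite /= ltn_add2l ir addKn ifF //; lia.
have leafE U : (nleaves U <= 1)%N -> U = Leaf.
  case: U => //= a b; have := nleaves_gt0 a; have := nleaves_gt0 b; lia.
by exists Leaf, 0%N; rewrite (leafE l) // (leafE r).
Qed.

Lemma nleaves_grow s m : nleaves (grow s m) = m.+1.
Proof. by elim: m => //= m IH; rewrite nleaves_split IH // ltn_ord. Qed.

Definition extend_growth (s : growth) (m i : nat) : growth :=
  fun k => if k == m then inord i else s k.

Lemma grow_ext s s' m : (forall k, (k < m)%N -> s k = s' k) ->
  grow s m = grow s' m.
Proof.
elim: m => //= m IH E; rewrite E // IH // => k km; apply: E; exact: leqW.
Qed.

Lemma extend_growth_lt s m i k : (k < m)%N -> extend_growth s m i k = s k.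
Proof. by move=> km; rewrite /extend_growth ltn_eqF. Qed.

Lemma extend_growth_at s m i : extend_growth s m i m = inord i.
Proof. by rewrite /extend_growth eqxx. Qed.

Lemma grow_surj m T : nleaves T = m.+1 -> exists s, grow s m = T.
Proof.
elim: m T => [|m IH] T TE.
  exists (fun _ => ord0); case: T TE => //= l r.
  have := nleaves_gt0 l; have := nleaves_gt0 r; lia.
have [|T' [i [iT' E]]] := @split_leaf_surj T; first by rewrite TE.
have T'E : nleaves T' = m.+1 by move: TE; rewrite E nleaves_split // => -[].
have [s sE] := IH T' T'E; exists (extend_growth s m i).
rewrite /= extend_growth_at inordK -?T'E // E -sE; congr split_leaf.
by apply: grow_ext => k km; rewrite extend_growth_lt.
Qed.

End TreeCombinatorics.

(** * The varieties X(T) *)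

Section TreeVarieties.
Variable K : closedFieldType.

Definition tree_lo (T : tree) (j b : nat) : Prop :=
  (b.+1 < nleaves T)%N /\ j = node_lo T b.

Definition tree_hi (T : tree) (j b : nat) : Prop :=
  (b.+1 < nleaves T)%N /\ j = node_hi T b.

Lemma Pop_tree m (i : 'I_m) T : nleaves T = m ->
  Pop i (constrained (K := K) (n := m) (tree_lo T) (tree_hi T)) =
  constrained (n := m.+1) (tree_lo (split_leaf T i)) (tree_hi (split_leaf T i)).
Proof.
move=> Tm; have im := ltn_ord i; have iT : (i < nleaves T)%N by rewrite Tm.
have [lo_i hi_i] := node_split iT.
have inT b : (b < m)%N ->
    ((bump i b).+1 < nleaves (split_leaf T i))%N = (b.+1 < nleaves T)%N.
  by move=> bm; rewrite nleaves_split // Tm /bump; lia.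
apply: Pop_constrained; rewrite /tree_lo /tree_hi.
- move=> j b _ bm; rewrite inT //.
  split; split=> -[bT E]; split=> //.
  + by move: E; rewrite node_lo_split // => /(can_inj (bumpK _)).
  + by rewrite node_lo_split // E.
  + by move: E; rewrite node_hi_split // => /(can_inj (bumpK _)).
  + by rewrite node_hi_split // E.
- move=> b bm bi; have bE : bump i (unbump i b) = b.
    by rewrite unbumpKcond (negbTE bi).
  have bT : (b.+1 < nleaves (split_leaf T i))%N ->
      ((unbump i b).+1 < nleaves T)%N.
    by rewrite nleaves_split // Tm /unbump; lia.
  split=> -[/bT {}bT]; rewrite -{1}bE.
    by rewrite node_lo_split //; apply/eqP; rewrite neq_bump.
  by rewrite node_hi_split //; apply/eqP; rewrite neq_bump.
- by move=> j [_ ->]; rewrite lo_i.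
- by move=> i0; rewrite lo_i nleaves_split // Tm.
- by move=> j [_ ->]; rewrite hi_i.
- by rewrite hi_i nleaves_split // Tm.
Qed.

Lemma growth_varietyE s m : growth_variety K s m =
  constrained (n := m.+1) (tree_lo (grow s m)) (tree_hi (grow s m)).
Proof.
elim: m => [|m IH] /=; last by rewrite IH Pop_tree // nleaves_grow.
apply/seteqP; split=> [G FG|G []//]; split=> // j b _.
by split=> -[].
Qed.

Lemma tree_varietyE m T : nleaves T = m.+1 ->
  tree_variety K m T = constrained (n := m.+1) (tree_lo T) (tree_hi T).
Proof.
move=> TE; apply/seteqP; split=> [G [s <-]|G GC].
  by rewrite growth_varietyE.
by have [s sE] := grow_surj TE; exists s => //; rewrite growth_varietyE sE.
Qed.

(** At each step the point (1 : 1) is chosen on the projective line. Then the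
    space in position i + 1 is G_i + <f + e_i>, and this new line contributes
    no coordinate vector. *)
Lemma generic_tree_flag s m : exists2 h : 'M[K]_m.+1,
    growth_variety K s m (flag_of_mx h) &
    forall (b : 'I_m.+1) q, (b < m)%N -> (q <= m.+1)%N ->
      (delta_mx b 0 \in subsp (flag_of_mx h) q) = (node_hi (grow s m) b <= q)%N.
Proof.
elim: m => [|m [h hG hi]].
  by exists 1%:M => //=; apply/Fl_flag_of_mx/unitmx1.
set T := grow s m in hi; set i := s m.
have Tm : nleaves T = m.+1 by exact: nleaves_grow.
have im := ltn_ord i; have iT : (i < nleaves T)%N by rewrite Tm.
have d0 : 1 * 1 - 1 * 0 != 0 :> K by rewrite mulr0 subr0 mulr1 oner_neq0.
have rel := pop_rel_flag i h d0; have [lo hi'] := rel.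
have FF : Fl K m.+1 (flag_of_mx h).
  by move: hG; rewrite growth_varietyE => -[].
have hu := Fl_unitmx FF.
exists (pop_mx i h 1 1 0 1).
  rewrite /= PopP; split; last by exists (flag_of_mx h).
  by apply/Fl_flag_of_mx/pop_mx_unit.
move=> b q bm qm; rewrite /= -/T -/i.
pose i' := widen_ord (leqnSn m.+1) i.
have [lo_i hi_i] := node_split iT.
have hi_T (b0 : 'I_m.+1) : (lift i' b0 < m.+1)%N ->
    (b0 < m)%N /\
    node_hi (split_leaf T i) (lift i' b0) = bump i.+1 (node_hi T b0).
  move=> b0m; have lt : (b0 < m)%N.
    by have := ltn_ord b0; move: b0m; rewrite /= /bump; lia.
  by rewrite node_hi_split // Tm.
case: (unliftP i' b) bm => [b0|] -> bm.
  have [b0m ->] := hi_T b0 bm.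
  have e0 : (delta_mx (lift i' b0) 0 : 'cV[K]_m.+2) i' 0 = 0.
    by rewrite mxE (negbTE (neq_lift _ _)).
  have eI : (insert0_mx K i')^T *m delta_mx (lift i' b0) 0 =
      delta_mx b0 0 :> 'cV_m.+1.
    by rewrite -insert0_delta tr_insert0K.
  have [qi|iq|->] := ltngtP q i.+1.
  - rewrite lo // mem_insert0 e0 eqxx eI hi //; last by lia.
    by rewrite /bump; lia.
  - case: q iq qm => // q iq qm.
    rewrite hi' ?mem_insert0_add; last by lia.
    rewrite eI hi //.
    by rewrite /bump; lia.
  - rewrite subsp_flag ?colspan_pop_mid; last by lia.
    set U := insert0 _ _; set v := _ + _.
    have <- : (delta_mx (lift i' b0) 0 \in U) =
              (bump i.+1 (node_hi T b0) <= i.+1)%N.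
      rewrite /U -(subsp_flag h (ltnW im)) mem_insert0 e0 eqxx eI hi ?(ltnW im) //.
      by rewrite /= /bump; lia.
    apply/idP/idP => [|eU]; last by apply: subvP eU; apply: addvSl.
    case/memv_addP => u uU [_ /vlineP[c ->] E].
    have c0 : c = 0.
      have := congr1 (fun x : 'cV_m.+2 => x i' 0) E; rewrite /= e0.
      move: uU; rewrite mem_insert0 => /andP[/eqP u0 _].
      rewrite /v !scale1r mxE u0 add0r mxE mxE insert0_at add0r mxE !eqxx mulr1.
      by move=> <-.
    by rewrite E c0 scale0r addr0.
rewrite hi_i.
have [qi|iq|->] := ltngtP q i.+1.
- by rewrite lo // mem_insert0 mxE !eqxx oner_eq0 /=; lia.
- case: q iq qm => // q iq qm.
  rewrite hi' ?mem_insert0_add; last by lia.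
  by rewrite tr_insert0_delta mem0v; lia.
- rewrite subsp_flag ?colspan_pop_mid; last by lia.
  set U := insert0 _ _; rewrite !scale1r; set f := _ *m col i h.
  apply/negP => /memv_addP[u uU [_ /vlineP[c ->] E]].
  have c1 : c = 1.
    have := congr1 (fun x : 'cV_m.+2 => x i' 0) E; rewrite /= mxE !eqxx.
    move: uU; rewrite mem_insert0 => /andP[/eqP u0 _].
    by rewrite mxE u0 add0r mxE mxE insert0_at add0r mxE !eqxx mulr1 => <-.
  have fU : f \in U.
    have -> : f = - u.
      apply/eqP; rewrite -addr_eq0 addrC; apply/eqP.
      move: E; rewrite c1 scale1r addrA => /eqP.
      by rewrite -subr_eq subrr => /eqP.
    by rewrite memvN.
  move: fU; rewrite mem_insert0 tr_insert0K => /andP[_ fh].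
  have : (colspan h i.+1 <= colspan h i)%VS.
    by rewrite colspanS subv_add subvv -memvE.
  by move=> /dimvS; rewrite !dim_colspan // ?ltnn // ltnW.
Qed.

Lemma tree_variety_inj m :
  {in Tree m.+1 &, injective (tree_variety K m)}.
Proof.
have le T T' : nleaves T = m.+1 -> nleaves T' = m.+1 ->
    tree_variety K m T = tree_variety K m T' ->
    forall b, (b.+1 < m.+1)%N -> (node_hi T b <= node_hi T' b)%N.
  move=> TE T'E E b bm.
  have [s sE] := grow_surj TE; have [h hG hi] := generic_tree_flag s m.
  have bm1 : (b < m.+1)%N by exact: ltnW.
  have hi_le : (node_hi T' b <= m.+1)%N by rewrite -T'E node_hi_le // T'E.
  rewrite -sE -(hi (Ordinal bm1)) //.
  have : tree_variety K m T' (flag_of_mx h) by rewrite -E; exists s.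
  rewrite tree_varietyE // => -[_ /(_ _ (Ordinal bm1) hi_le)[_]]; apply.
  by split=> //; rewrite T'E.
move=> T T'; rewrite !inE /Tree /= => TE T'E E.
apply: node_hi_inj => [|b]; rewrite ?TE // => bm.
by apply/eqP; rewrite eqn_leq !le.
Qed.


End TreeVarieties.

(** * Trees and permutations *)

Section GrowthPermutations.
Variable K : closedFieldType.

Lemma constrained_ext n (L H L' H' : nat -> nat -> Prop) :
    (forall j b, (j <= n)%N -> (b < n)%N ->
       (L j b <-> L' j b) /\ (H j b <-> H' j b)) ->
  constrained (K := K) (n := n) L H = constrained L' H'.
Proof.
move=> E; apply/seteqP; split=> G [FG CG]; split=> // j b jn.
  have [[_ LL] [_ HH]] := E j b jn (ltn_ord b).
  by have [CL CH] := CG j b jn; split=> [/LL|/HH].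
have [[LL _] [HH _]] := E j b jn (ltn_ord b).
by have [CL CH] := CG j b jn; split=> [/LL|/HH].
Qed.

Lemma Fl1_perm w : Fl K 1 = constrained (perm_lo w) (perm_hi w).
Proof.
apply/seteqP; split=> [G FG|G []//]; split=> // j b j1.
rewrite /perm_lo /perm_hi (ord1 b) /=.
by case: j j1 => [|[|j]] //= _; split.
Qed.

(** Remove the smallest label repeatedly; its position is the leaf split last.
    *)
Lemma growth_of_labels m (w : nat -> nat) :
    (forall a b, (a <= m)%N -> (b <= m)%N -> w a = w b -> a = b) ->
    (forall a, (a < m)%N -> (w a < w m)%N) ->
  exists s, growth_variety K s m =
            constrained (n := m.+1) (perm_lo w) (perm_hi w).
Proof.
elim: m w => [|m IH] w w_inj w_max.
  by exists (fun _ => ord0); rewrite /= (Fl1_perm w).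
have [i [wi wi_inj wi_max]] := min_label w_inj w_max.
have [s sE] := IH _ wi_inj wi_max; exists (extend_growth s m i).
rewrite -(Pop_perm K wi) -sE /= extend_growth_at inord_val; congr Pop.
rewrite !growth_varietyE (@grow_ext _ s) // => k km.
by rewrite extend_growth_lt.
Qed.

(** Splitting leaf i amounts to inserting a new smallest label at i, after the
    other labels are raised by 1. *)
Lemma labels_of_growth s m : exists w : nat -> nat,
  [/\ forall a b, (a <= m)%N -> (b <= m)%N -> w a = w b -> a = b,
      forall a, (a <= m)%N -> (w a <= m)%N, w m = m &
      growth_variety K s m =
      constrained (n := m.+1) (perm_lo w) (perm_hi w)].
Proof.
elim: m => [|m [w [w_inj w_le w_m E]]].
  exists (fun=> 0%N); split=> //; last exact: Fl1_perm.
  by move=> [|a] [|b].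
pose i := s m; have im := ltn_ord i.
pose v (x : nat) := if x == i then 0%N else (w (unbump i x)).+1.
have v_bump x : v (bump i x) = (w x).+1.
  by rewrite /v eq_sym (negbTE (neq_bump _ _)) bumpK.
have v_i : v i = 0%N by rewrite /v eqxx.
have bumpP (a : nat) : (a <= m.+1)%N -> a != i ->
    exists2 b, (b <= m)%N & a = bump i b.
  move=> am ai; exists (unbump i a); first by rewrite /unbump; lia.
  by rewrite unbumpKcond (negbTE ai).
exists v; split.
- move=> a b am bm; have [->|ai] := eqVneq (a : nat) i;
    have [->|bi] := eqVneq (b : nat) i => //.
  + by have [b' _ ->] := bumpP b bm bi; rewrite v_bump v_i.
  + by have [a' _ ->] := bumpP a am ai; rewrite v_bump v_i.
  have [a' a'm ->] := bumpP a am ai; have [b' b'm ->] := bumpP b bm bi.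
  by rewrite !v_bump => -[] /w_inj ->.
- move=> a am; have [->|ai] := eqVneq (a : nat) i; first by rewrite v_i.
  by have [a' a'm ->] := bumpP a am ai; rewrite v_bump ltnS w_le.
- have -> : m.+1 = bump i m by rewrite /bump; lia.
  by rewrite v_bump w_m /bump; lia.
rewrite -(Pop_perm K (i := i)) => [|a am ai].
  rewrite /= E -/i; congr Pop; apply: constrained_ext => j b jm bm.
  by rewrite /perm_lo /perm_hi /= !v_bump.
by have [a' a'm ->] := bumpP a am ai; rewrite v_bump v_i.
Qed.

Lemma growth_of_perm n (w : 'S_n.+1) : fix_last n w ->
  exists s, growth_variety K s n = translated_richardson K w.
Proof.
move=> w_last; rewrite translated_richardsonE //.
have [w_inj w_max] := perm_nat_labels w_last.
exact: growth_of_labels.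
Qed.

Lemma perm_of_growth s n : exists2 w : 'S_n.+1, fix_last n w &
  growth_variety K s n = translated_richardson K w.
Proof.
have [w [w_inj w_le w_n E]] := labels_of_growth s n.
pose f (a : 'I_n.+1) : 'I_n.+1 := inord (w a).
have fE a : f a = w a :> nat by rewrite inordK // ltnS w_le // -ltnS.
have f_inj : injective f.
  move=> a b /(congr1 val); rewrite /= !fE => /w_inj E'.
  by apply: ord_inj; apply: E'; rewrite -ltnS.
have w_last : fix_last n (perm f_inj).
  by apply: ord_inj; rewrite permE fE.
exists (perm f_inj) => //; rewrite translated_richardsonE // E.
have pE b : (b <= n)%N -> perm_nat (perm f_inj) b = w b.
  by move=> bn; rewrite /perm_nat permE fE inordK.
apply: constrained_ext => j b jn bn.
rewrite /perm_lo /perm_hi pE //.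
by case: j jn => // j jn; rewrite /= pE.
Qed.

Lemma tree_varieties_eq n :
  tree_variety K n @` Tree n.+1 = translated_richardson K @` fix_last n.
Proof.
apply/seteqP; split=> [_ [T TE <-]|_ [w w_last <-]].
  have [s sE] := grow_surj TE; have [w w_last E] := perm_of_growth s n.
  by exists w => //; rewrite -E growth_varietyE sE tree_varietyE.
have [s E] := growth_of_perm w_last; exists (grow s n).
  exact: nleaves_grow.
by rewrite tree_varietyE ?nleaves_grow // -growth_varietyE.
Qed.

End GrowthPermutations.

(** * Counting trees *)

Section Catalan.

HB.instance Definition _ := gen_eqMixin tree.

(** Lists of k trees with n internal nodes altogether: each tree has one more
    leaf than internal nodes. *)
Definition forest n k (f : seq tree) : bool :=
  (size f == k) && (sumn (map nleaves f) == n + k)%N.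

Definition join_trees (f : seq tree) : seq tree :=
  if f is l :: r :: f' then Node l r :: f' else f.

Lemma size_le_leaves f : (size f <= sumn (map nleaves f))%N.
Proof. by elim: f => //= T f IH; have := nleaves_gt0 T; lia. Qed.

(** The first tree of a nonempty forest is either a leaf, to be removed, or a
    node, to be replaced by its two subtrees; this gives the ballot recurrence
    B(n, k + 1) = B(n, k) + B(n - 1, k + 2), solved by C(2n + k - 1, n) - C(2n
    + k - 1, n - 1), here stated without subtraction. *)
Lemma forest_enum n k : exists e : seq (seq tree),
  [/\ uniq e, e =i forest n k &
      (size e + (if n is n'.+1 then 'C((2 * n + k).-1, n') else 0) =
       'C((2 * n + k).-1, n))%N].
Proof.
elim: n k => [|n IHn] k.
  exists [:: nseq k Leaf]; split=> // [f|]; last by rewrite bin0.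
  rewrite inE /in_mem /= /forest add0n; apply/eqP/andP => [->|[/eqP sf /eqP lf]].
    by rewrite size_nseq eqxx map_nseq sumn_nseq mul1n.
  rewrite -{}sf in lf *; elim: f lf => //= T f IH lf.
  have := size_le_leaves f; have T0 := nleaves_gt0 T => sf.
  rewrite -IH; last by lia.
  have : (nleaves T <= 1)%N by lia.
  case: T T0 {lf} => //= l r.
  by have := nleaves_gt0 l; have := nleaves_gt0 r; lia.
elim: k => [|k [e [e_uniq e_mem e_size]]].
  exists [::]; split=> // [f|].
    by rewrite /in_mem /= /forest; case: f.
  rewrite add0n (_ : (2 * n.+1 + 0).-1 = (n + n.+1)%N); last by lia.
  by rewrite -[in RHS]bin_sub ?addnK //; lia.
have [e' [e'_uniq e'_mem e'_size]] := IHn k.+2.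
have e'2 f : f \in e' -> (1 < size f)%N.
  by rewrite e'_mem => /andP[/eqP ->].
exists (map (cons Leaf) e ++ map join_trees e'); split.
- rewrite cat_uniq !map_inj_in_uniq ?e_uniq ?e'_uniq /=; last 2 first.
  + move=> f f' /e'2 + /e'2.
    by case: f => [|l [|r f]] //; case: f' => [|l' [|r' f']] //= _ _ [-> -> ->].
  + by move=> f f' _ _ [].
  rewrite andbT; apply/hasPn => _ /mapP[f /e'2 + ->].
  case: f => [|l [|r f]] //= _; apply/negP => /mapP[f' _] //.
- move=> f; rewrite mem_cat; apply/orP/idP => [[/mapP[f' + ->]|/mapP[f' + ->]]|].
  + rewrite e_mem => /andP[/eqP sf /eqP lf].
    by rewrite /in_mem /= /forest /= sf lf eqxx; apply/eqP; lia.
  + rewrite e'_mem => /andP[/eqP sf /eqP lf].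
    case: f' sf lf => [|l [|r f']] //= [sf] lf.
    by rewrite /in_mem /= /forest /= sf eqxx; apply/eqP; lia.
  rewrite /in_mem /= /forest; case: f => [|[|l r] f] //= /andP[/eqP[sf] /eqP lf].
    left; apply: map_f; rewrite e_mem /in_mem /= /forest sf eqxx.
    by apply/eqP; lia.
  right; apply/mapP; exists [:: l, r & f] => //.
  by rewrite e'_mem /in_mem /= /forest /= sf eqxx; apply/eqP; lia.
rewrite size_cat !size_map.
have a1 : (2 * n.+1 + k.+1).-1 = (2 * n.+1 + k).-1.+1 by lia.
have a2 : (2 * n + k.+2).-1 = (2 * n.+1 + k).-1 by lia.
rewrite a1 !binS; rewrite a2 in e'_size.
case: n {IHn e_mem e'_mem e'2 e'_uniq a1 a2} e_size e'_size => [|n] e_size e'_size.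
  by rewrite !bin0 in e_size e'_size *; lia.
by rewrite !binS in e_size e'_size *; lia.
Qed.

Lemma card_Tree n : (Tree n.+1 #= `I_(catalan n))%card.
Proof.
have [e [e_uniq e_mem e_size]] := forest_enum n 1.
pose f k := head Leaf (nth [::] e k).
have e1 k : (k < size e)%N -> nth [::] e k = [:: f k].
  move=> ke; have := mem_nth [::] ke; rewrite e_mem => /andP[].
  by rewrite /f; case: (nth _ _ _) => [|T []].
have sizeE : size e = catalan n.
  have := catalanE n; have := mul_bin_left (2 * n) n.-1.
  case: n {f e1 e_mem e_uniq} e_size => [|n] e_size.
    by move: e_size; rewrite addn0 bin0 => -> _ _; rewrite /catalan bin0.
  have {e_size} E1 : (size e + 'C((2 * n.+1 + 1).-1, n) =
                      'C((2 * n.+1 + 1).-1, n.+1))%N by [].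
  rewrite [n.+1.-1]/= (_ : (2 * n.+1 - n = n.+2)%N); last by lia.
  rewrite addn1 -pred_Sn in E1 => E2 E3.
  suff : (n.+2 * size e = n.+2 * catalan n.+1)%N.
    by move/eqP; rewrite eqn_pmul2l // => /eqP.
  by rewrite E3; nia.
have -> : Tree n.+1 = f @` `I_(size e).
  apply/seteqP; split=> [T TE|_ [k ke <-]].
    have Te : [:: T] \in e.
      by rewrite e_mem /in_mem /= /forest /= addn0 TE addn1 eqxx.
    exists (index [:: T] e); first by rewrite /= index_mem.
    by rewrite /f nth_index.
  have := mem_nth [::] ke; rewrite e1 // e_mem => /andP[_ /=].
  by rewrite addn0 addn1 => /eqP.
rewrite -sizeE; apply: inj_card_eq => j k; rewrite !inE => je ke fjk.
by apply/eqP; rewrite -(nth_uniq [::] je ke e_uniq) !e1 ?fjk.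
Qed.
End Catalan.

Local Open Scope card_scope.

Theorem theorem7p1 (R : realType) (n : nat) :
  [/\ tree_variety R[i] n @` Tree n.+1 =
        translated_richardson R[i] @` fix_last n,
      translated_richardson R[i] @` fix_last n #= `I_(catalan n) &
      set_bij (Tree n.+1) (translated_richardson R[i] @` fix_last n)
        (tree_variety R[i] n)].
Proof.
have inj := @tree_variety_inj R[i] n.
have E := tree_varieties_eq R[i] n; split=> //; rewrite -E.
  exact: card_eq_trans (inj_card_eq inj) (card_Tree n).
exact: inj_bij.
Qed.
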